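(* Let $G$ be a group and $k$ a commutative ring. The full subcategory $\mathrm{FI}_G\text{-Mod}^{coh}$ of the category of $\mathrm{FI}_G$-modules over $k$ consisting of the degree-wise coherent modules is an abelian category.
   Context: $\mathrm{FI}_G$ is the category whose objects are the sets $[n]=\{1,\ldots,n\}$, $n \ge 0$, and whose morphisms $(f,g):[n]\to[m]$ are pairs of an injection $f:[n]\to[m]$ and an arbitrary map of sets $g:[n]\to G$; composition is $(f,g)\circ(h,g') = (f\circ h, g'')$ with $g''(x) = g'(x)\cdot g(h(x))$. Write $G_r = \operatorname{End}_{\mathrm{FI}_G}([r])$. An $\mathrm{FI}_G$-module over $k$ is a functor $V:\mathrm{FI}_G \to k\text{-Mod}$, with $V_n = V([n])$; the category of all $\mathrm{FI}_G$-modules (with natural transformations) is abelian, with kernels and cokernels computed pointwise. For a $kG_r$-module $W$, the free module $M(W)$ has $M(W)_n = k[\operatorname{Hom}_{\mathrm{FI}_G}([r],[n])]\otimes_{kG_r} W$, with induced maps acting by composition on the first factor; it is generated in degree $r$. A free module is a direct sum of such modules, and its generating degree is the supremum of the degrees $r$ of its summands. $V$ is generated in finite degree if there is $N$ such that no proper submodule of $V$ contains $\bigsqcup_{n\le N} V_n$. $V$ is degree-wise coherent if there is an exact sequence $0\to K\to F\to V\to 0$ with $F$ a free module of finite generating degree and $K$ generated in finite degree. *)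

(* Defs.v *)
From HB Require Import structures.
From mathcomp Require Import all_boot all_order all_algebra.

Set Implicit Arguments.
Unset Strict Implicit.
Unset Printing Implicit Defensive.
Import GRing.Theory.
Local Open Scope ring_scope.

Record group := Group {
  gcar :> Type;
  gmul : gcar -> gcar -> gcar;
  gone : gcar;
  ginv : gcar -> gcar;
  gmulA : associative gmul;
  gmul1 : left_id gone gmul;
  gmulV : left_inverse gone ginv gmul }.

Lemma injectiveb_comp (l n m : nat) (f : {ffun 'I_n -> 'I_m})
  (h : {ffun 'I_l -> 'I_n}) :
  injectiveb f -> injectiveb h -> injectiveb [ffun x => f (h x)].
Proof.
move=> /injectiveP Hf /injectiveP Hh; apply/injectiveP => x y.
by rewrite !ffunE => /Hf /Hh.
Qed.

Lemma injectiveb_id (n : nat) : injectiveb [ffun x : 'I_n => x].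
Proof. by apply/injectiveP => x y; rewrite !ffunE. Qed.

Section FIG.
Variable G : group.
Variable k : comPzRingType.

(* Morphisms [n] -> [m] of FI_G : an injection f and a map g : [n] -> G.
   ([n] = {1,..,n} is represented by 'I_n = {0,..,n-1}.) *)
Record FIhom (n m : nat) := FIHom {
  hf : {ffun 'I_n -> 'I_m};
  hf_inj : injectiveb hf;
  hg : {ffun 'I_n -> G} }.

Definition FIcomp (l n m : nat) (a : FIhom n m) (b : FIhom l n) : FIhom l m :=
  @FIHom l m [ffun x => hf a (hf b x)]
    (injectiveb_comp (hf_inj a) (hf_inj b))
    [ffun x => gmul (hg b x) (hg a (hf b x))].

Definition FIid (n : nat) : FIhom n n :=
  @FIHom n n [ffun x => x] (injectiveb_id n) [ffun=> gone G].

Record FImod := FIMod {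
  Vobj :> nat -> lmodType k;
  Vmap : forall n m, FIhom n m -> {linear Vobj n -> Vobj m};
  Vmap_id : forall n x, Vmap (FIid n) x = x;
  Vmap_comp : forall l n m (a : FIhom n m) (b : FIhom l n) x,
      Vmap (FIcomp a b) x = Vmap a (Vmap b x) }.

Record FImor (V W : FImod) := FIMor {
  mor :> forall n, {linear V n -> W n};
  mor_nat : forall n m (a : FIhom n m) x,
      mor m (Vmap V a x) = Vmap W a (mor n x) }.

Definition meq (V W : FImod) (u v : FImor V W) := forall n x, u n x = v n x.

Definition is_submodule (V : FImod) (S : forall n, V n -> Prop) :=
  [/\ (forall n, S n 0),
      (forall n x y, S n x -> S n y -> S n (x + y)),
      (forall n (c : k) x, S n x -> S n (c *: x))
    & forall n m (a : FIhom n m) x, S n x -> S m (Vmap V a x)].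

Definition gen_fin_deg (V : FImod) :=
  exists N : nat, forall S, @is_submodule V S ->
    (forall n, (n <= N)%N -> forall x, S n x) -> forall n x, S n x.

(* kG_r-modules, G_r = End_{FI_G}([r]) acting on the left *)
Record GrMod (r : nat) := GrModule {
  gm :> lmodType k;
  gm_act : FIhom r r -> {linear gm -> gm};
  gm_act_id : forall w, gm_act (FIid r) w = w;
  gm_act_comp : forall a b w, gm_act (FIcomp a b) w = gm_act a (gm_act b w) }.

(* F is a free module of finite generating degree: F is (canonically) the
   direct sum over i in I of the free modules M(W_i) generated in degree
   r_i <= d; M(W) = k[Hom([r],-)] (x)_{kG_r} W is encoded by its defining
   universal property (j_i : W_i -> F_{r_i} is the inclusion w |-> id (x) w). *)
Definition free_fin_gen (F : FImod) :=
  exists (d : nat) (I : Type) (r : I -> nat) (W : forall i, GrMod (r i))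
         (j : forall i, {linear W i -> F (r i)}),
  [/\ (forall i, (r i <= d)%N),
      (forall i (a : FIhom (r i) (r i)) w,
          j i (gm_act (W i) a w) = Vmap F a (j i w))
    & forall (V : FImod) (t : forall i, {linear W i -> V (r i)}),
        (forall i (a : FIhom (r i) (r i)) w,
            t i (gm_act (W i) a w) = Vmap V a (t i w)) ->
        exists u : FImor F V,
          (forall i w, u (r i) (j i w) = t i w) /\
          (forall u' : FImor F V, (forall i w, u' (r i) (j i w) = t i w) ->
             meq u' u)].

Definition dw_coherent (V : FImod) :=
  exists (K F : FImod) (iota : FImor K F) (pi : FImor F V),
  [/\ free_fin_gen F, gen_fin_deg K,
      (forall n, injective (iota n)),
      (forall n (y : V n), exists x, pi n x = y)
    & (forall n (x : F n), pi n x = 0 <-> exists y, iota n y = x)].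

(* ---- Abelianness of the full subcategory on objects satisfying P ----
   Hom-sets carry the (pointwise) k-module structure of natural
   transformations, so the subcategory is preadditive with bilinear
   composition; all universal properties below are taken INSIDE the
   full subcategory. *)
Section Abelian.
Variable P : FImod -> Prop.

Definition is_kernel (X Y : FImod) (f : FImor X Y) (K : FImod)
    (e : FImor K X) :=
  (forall n x, f n (e n x) = 0) /\
  forall T, P T -> forall h : FImor T X, (forall n x, f n (h n x) = 0) ->
    exists u : FImor T K, (forall n x, e n (u n x) = h n x) /\
      forall u' : FImor T K, (forall n x, e n (u' n x) = h n x) -> meq u' u.

Definition is_cokernel (X Y : FImod) (f : FImor X Y) (C : FImod)
    (q : FImor Y C) :=
  (forall n x, q n (f n x) = 0) /\
  forall T, P T -> forall h : FImor Y T, (forall n x, h n (f n x) = 0) ->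
    exists u : FImor C T, (forall n y, u n (q n y) = h n y) /\
      forall u' : FImor C T, (forall n y, u' n (q n y) = h n y) -> meq u' u.

Definition is_mono (X Y : FImod) (f : FImor X Y) :=
  forall T, P T -> forall g1 g2 : FImor T X,
    (forall n x, f n (g1 n x) = f n (g2 n x)) -> meq g1 g2.

Definition is_epi (X Y : FImod) (f : FImor X Y) :=
  forall T, P T -> forall g1 g2 : FImor Y T,
    (forall n y, g1 n (f n y) = g2 n (f n y)) -> meq g1 g2.

Definition has_zero_object :=
  exists Z, P Z /\ forall X, P X ->
    ((exists _ : FImor Z X, True) /\ forall u v : FImor Z X, meq u v) /\
    ((exists _ : FImor X Z, True) /\ forall u v : FImor X Z, meq u v).

Definition has_biproducts :=
  forall X Y, P X -> P Y -> exists S, P S /\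
    exists (i1 : FImor X S) (i2 : FImor Y S) (p1 : FImor S X)
           (p2 : FImor S Y),
    [/\ (forall n x, p1 n (i1 n x) = x),
        (forall n y, p2 n (i2 n y) = y),
        (forall n x, p2 n (i1 n x) = 0),
        (forall n y, p1 n (i2 n y) = 0)
      & (forall n s, i1 n (p1 n s) + i2 n (p2 n s) = s)].

Definition has_kernels :=
  forall X Y (f : FImor X Y), P X -> P Y ->
    exists K (e : FImor K X), P K /\ is_kernel f e.

Definition has_cokernels :=
  forall X Y (f : FImor X Y), P X -> P Y ->
    exists C (q : FImor Y C), P C /\ is_cokernel f q.

Definition monos_are_kernels :=
  forall X Y (f : FImor X Y), P X -> P Y -> is_mono f ->
    exists Z (g : FImor Y Z), P Z /\ is_kernel g f.

Definition epis_are_cokernels :=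
  forall X Y (f : FImor X Y), P X -> P Y -> is_epi f ->
    exists W (g : FImor W X), P W /\ is_cokernel g f.

Definition abelian_full_subcat :=
  has_zero_object /\ has_biproducts /\ has_kernels /\ has_cokernels /\
  monos_are_kernels /\ epis_are_cokernels.

End Abelian.
End FIG.

(* Main.v *)
Require Import Defs.
From HB Require Import structures.
From mathcomp Require Import all_boot all_order all_algebra.
From mathcomp Require Import boolp.

(** Call [V] FP when it is generated in finite degree and every surjection onto
    [V] from a module generated in finite degree has kernel generated in finite
    degree. Free modules are FP by their universal property, and degree-wise
    coherence turns out to be the same as FP. Everything reduces to showing
    that a submodule [K], generated in finite degree, of a free module [F] of
    finite generating degree is FP.

    This goes by induction on the generating degree of [F], through the
    derivative [DV = coker (V -> shift V)]. The map [F -> shift F] is injective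
    and [DF] embeds in a module of smaller generating degree, so the image of
    [DK -> DF] is FP by induction. Hence the kernel of [DK -> DF] is generated
    in finite degree; it is killed by the standard inclusions, so it vanishes
    in large degrees, and is therefore FP. So [DK] is FP, being an extension,
    and this passes to [K] because [K -> shift K] is injective and a module is
    generated in finite degree as soon as its derivative is. *)

Set Implicit Arguments.
Unset Strict Implicit.
Unset Printing Implicit Defensive.
Import GRing.Theory.
Local Open Scope ring_scope.

(** * Linear maps and modules from raw data *)

Definition linear_of (k : pzRingType) (U V : lmodType k) (f : U -> V)
    (f_lin : linear f) : {linear U -> V} :=
  HB.pack f (GRing.isLinear.Build k U V *:%R f f_lin).

Section LmodOf.
Variables (k : pzRingType) (T : Type).
Variables (zero : T) (opp : T -> T) (add : T -> T -> T) (scale : k -> T -> T).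
Hypotheses (addA : associative add) (addC : commutative add)
  (add0 : left_id zero add) (addN : left_inverse zero opp add).
Hypotheses (scaleA : forall a b v, scale a (scale b v) = scale (a * b) v)
  (scale1 : left_id 1 scale) (scaleDr : right_distributive scale add)
  (scaleDl : forall v a b, scale (a + b) v = add (scale a v) (scale b v)).

Definition lmod_of : lmodType k :=
  let C : choiceType := HB.pack T (gen_eqMixin T) (gen_choiceMixin T) in
  let Z : zmodType :=
    HB.pack T C (GRing.isZmodule.Build C addA addC add0 addN) in
  HB.pack T Z (GRing.Zmodule_isLmodule.Build k Z scaleA scale1 scaleDr scaleDl).
End LmodOf.

(** * The category FI_G *)

Section FIcategory.
Variable G : group.

Lemma gmulVr (g : G) : gmul g (ginv g) = gone G.
Proof.
rewrite -[gmul g _](gmul1 (g := G)) -{1}(gmulV (ginv g)) -gmulA.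
by rewrite [gmul (ginv g) (gmul g _)]gmulA gmulV gmul1 gmulV.
Qed.

Lemma gmul1r (g : G) : gmul g (gone G) = g.
Proof. by rewrite -(gmulV g) gmulA gmulVr gmul1. Qed.

Lemma gmulIr (h : G) : injective (fun g => gmul g h).
Proof.
move=> g1 g2 /(congr1 (fun g => gmul g (ginv h))).
by rewrite -!gmulA gmulVr !gmul1r.
Qed.

Implicit Types l n m : nat.

Lemma FIhom_eq n m (a b : FIhom G n m) : hf a =1 hf b -> hg a =1 hg b -> a = b.
Proof.
case: a b => f fi g [f' fi' g'] /= /ffunP ef /ffunP eg; subst f' g'.
by rewrite (eq_irrelevance fi fi').
Qed.

Lemma FIcompA l n m p (a : FIhom G m p) (b : FIhom G n m) (c : FIhom G l n) :
  FIcomp a (FIcomp b c) = FIcomp (FIcomp a b) c.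
Proof. by apply: FIhom_eq => x; rewrite !ffunE ?gmulA. Qed.

Lemma FIcomp1l n m (a : FIhom G n m) : FIcomp (FIid G m) a = a.
Proof. by apply: FIhom_eq => x; rewrite !ffunE ?gmul1r. Qed.

Lemma FIcomp1r n m (a : FIhom G n m) : FIcomp a (FIid G n) = a.
Proof. by apply: FIhom_eq => x; rewrite !ffunE ?gmul1. Qed.

Lemma hfI n m (a : FIhom G n m) : injective (hf a).
Proof. exact/injectiveP/hf_inj. Qed.

(** The injection of [a] cancels first; the labels then share a right factor in [G]. This is what
    makes extension by zero in [push] well defined. *)
Lemma FIcompI l n m (a : FIhom G n m) (b c : FIhom G l n) :
  FIcomp a b = FIcomp a c -> b = c.
Proof.
move=> e; have ef x : hf b x = hf c x.
  by have := congr1 (fun h => hf h x) e; rewrite !ffunE => /hfI.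
apply: FIhom_eq => // x.
by have := congr1 (fun h => hg h x) e; rewrite !ffunE ef => /gmulIr.
Qed.

Lemma FIhom_leq n m (a : FIhom G n m) : (n <= m)%N.
Proof. by have := leq_card _ (@hfI _ _ a); rewrite !card_ord. Qed.

(** Labels can be divided in [G], so only the images obstruct a factorization. *)
Lemma FI_factor l n m (a : FIhom G n m) (h : FIhom G l m) :
  (forall x, exists y, hf a y = hf h x) -> exists b, h = FIcomp a b.
Proof.
move=> /choice[f ef].
have fi : injectiveb (finfun f).
  apply/injectiveP => x y; rewrite !ffunE => e.
  by apply: (@hfI _ _ h); rewrite -!ef e.
exists (FIHom fi [ffun x => gmul (hg h x) (ginv (hg a (f x)))]).
apply: FIhom_eq => x; rewrite !ffunE ?ef //.
by rewrite -gmulA gmulV gmul1r.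
Qed.

(** An injective self-map of a finite set is onto, so the identity factors through [a]; cancelling
    [a] makes the inverse two-sided. *)
Lemma FIendo_inv n (a : FIhom G n n) :
  exists b, FIcomp a b = FIid G n /\ FIcomp b a = FIid G n.
Proof.
have [|b e] := @FI_factor n n n a (FIid G n).
  by move=> x; exists (invF (@hfI _ _ a) x); rewrite f_invF ffunE.
exists b; split=> //; apply: (@FIcompI _ _ _ a).
by rewrite FIcompA -e FIcomp1l FIcomp1r.
Qed.

Lemma FIiota_inj n : injectiveb [ffun x : 'I_n => lift ord0 x].
Proof. by apply/injectiveP => x y; rewrite !ffunE => /lift_inj. Qed.

Definition FIiota n : FIhom G n n.+1 :=
  FIHom (FIiota_inj n) [ffun=> gone G].

Lemma FIext_inj n m (a : FIhom G n m) (z : 'I_m) :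
  (forall x, hf a x != z) ->
  injectiveb [ffun y => if unlift ord0 y is Some x then hf a x else z].
Proof.
move=> nz; apply/injectiveP => x y; rewrite !ffunE.
case: unliftP => [x'|] -> ; case: unliftP => [y'|] -> //.
- by move/hfI ->.
- by move/eqP; rewrite (negbTE (nz _)).
- by move/esym/eqP; rewrite (negbTE (nz _)).
Qed.

Definition FIext n m (a : FIhom G n m) (z : 'I_m) (nz : forall x, hf a x != z) :
    FIhom G n.+1 m :=
  FIHom (FIext_inj nz)
    [ffun y => if unlift ord0 y is Some x then hg a x else gone G].

Lemma FIextK n m (a : FIhom G n m) z (nz : forall x, hf a x != z) :
  FIcomp (FIext nz) (FIiota n) = a.
Proof. by apply: FIhom_eq => x; rewrite !ffunE liftK ?gmul1. Qed.

(** Counting yields a point missed by [a], and the new point can be sent there. *)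
Lemma FI_factor_iota n m (a : FIhom G n m) :
  (n < m)%N -> exists b, a = FIcomp b (FIiota n).
Proof.
move=> ltnm; have [z nz] : exists z, forall x, hf a x != z.
  apply: contrapT => H.
  have : (#|'I_m| <= #|codom (hf a)|)%N.
    apply/subset_leq_card/subsetP => z _; apply: contrapT => zn; apply: H.
    by exists z => x; apply/eqP => e; apply: zn; rewrite -e codom_f.
  rewrite (card_codom (@hfI _ _ a)) [#|'I_m|]card_ord [#|'I_n|]card_ord.
  by rewrite leqNgt ltnm.
by exists (FIext nz); rewrite FIextK.
Qed.

Lemma FIup_subproof n m (a : FIhom G n m) x :
  hf (FIcomp (FIiota m) a) x != ord0.
Proof. by rewrite !ffunE eq_sym neq_lift. Qed.

(** The endofunctor that adjoins the point [ord0], fixed with trivial label; the shift of a module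
    is restriction along it. *)
Definition FIup n m (a : FIhom G n m) : FIhom G n.+1 m.+1 :=
  FIext (FIup_subproof a).

Lemma FIup_iota n m (a : FIhom G n m) :
  FIcomp (FIup a) (FIiota n) = FIcomp (FIiota m) a.
Proof. exact: FIextK. Qed.

Lemma FIup_id n : FIup (FIid G n) = FIid G n.+1.
Proof.
by apply: FIhom_eq => x; rewrite !ffunE;
  case: unliftP => [y e|e] //; rewrite ?e !ffunE ?gmul1.
Qed.

Lemma FIup_comp l n m (a : FIhom G n m) (b : FIhom G l n) :
  FIup (FIcomp a b) = FIcomp (FIup a) (FIup b).
Proof.
by apply: FIhom_eq => x; rewrite !ffunE;
  case: unliftP => [y e|e]; rewrite ?ffunE ?liftK ?unlift_none
     ?ffunE ?gmul1r ?gmul1.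
Qed.

Lemma FIpoint_inj n (x : 'I_n) :
  injectiveb [ffun y => if unlift x y is Some z then lift ord0 z
                        else ord0 : 'I_n.-1.+1].
Proof.
apply/injectiveP => y z; rewrite !ffunE.
by case: unliftP => [y'|] ->; case: unliftP => [z'|] -> // /lift_inj ->.
Qed.

(** Makes [x] the adjoined point. As [x] exists, [n.-1.+1] equals [n]; this spelling needs no cast
    and allows composition with [FIup]. *)
Definition FIpoint n (x : 'I_n) (g : G) : FIhom G n n.-1.+1 :=
  FIHom (FIpoint_inj x) [ffun y => if y == x then g else gone G].

(** The cases are whether [a] misses or hits [ord0]. In the second, deleting the preimage leaves a
    morphism from a set with one point fewer; this is why derivatives lower the generating
    degree. *)
Lemma FI_split n m (a : FIhom G n m.+1) :
  (exists b, a = FIcomp (FIiota m) b) \/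
  (exists x g b, a = FIcomp (FIup b) (FIpoint x g)).
Proof.
case: (pselect (exists x, hf a x = ord0)) => [[x ax]|nx]; [right|left].
  have fi : injectiveb [ffun y => hf a (lift x y)].
    by apply/injectiveP => y z; rewrite !ffunE => /hfI /lift_inj.
  have [|b eb] := FI_factor (a := FIiota m)
      (h := FIHom fi [ffun y => hg a (lift x y)]).
    move=> y; rewrite !ffunE; case: (unliftP ord0 (hf a (lift x y))) => [z ->|].
      by exists z; rewrite ffunE.
    by rewrite -ax => /hfI e; have := neq_lift x y; rewrite e eqxx.
  have ef z : lift ord0 (hf b z) = hf a (lift x z).
    by have := congr1 (fun h => hf h z) eb; rewrite !ffunE.
  have eg z : hg b z = hg a (lift x z).
    by have := congr1 (fun h => hg h z) eb; rewrite !ffunE gmul1r.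
  exists x, (hg a x), b; apply: FIhom_eq => y; rewrite !ffunE /=.
    case: (unliftP x y) => [z|] ->; last by rewrite unlift_none.
    by rewrite liftK !ffunE ef.
  case: (unliftP x y) => [z|] ->; last by rewrite unlift_none eqxx gmul1r.
  by rewrite liftK !ffunE eq_sym (negbTE (neq_lift _ _)) gmul1 gmul1r eg.
apply: FI_factor => x; case: (unliftP ord0 (hf a x)) => [z ->|e].
  by exists z; rewrite ffunE.
by case: nx; exists x.
Qed.
End FIcategory.

(** * Submodules, quotients, factorizations *)

Section Submodules.
Variables (G : group) (k : comPzRingType).
Local Notation FImod := (FImod G k).
Implicit Types U V W X : FImod.

Definition FImor_of V W (f : forall n, V n -> W n)
    (f_lin : forall n, linear (f n))
    (f_nat : forall n m (a : FIhom G n m) x,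
        f m (Vmap V a x) = Vmap W a (f n x)) :
    FImor V W :=
  FIMor (mor := fun n => linear_of (f_lin n)) f_nat.

Lemma linear_comp_mor U V W (g : FImor V W) (f : FImor U V) n :
  linear (fun x => g n (f n x)).
Proof. by move=> c x y; rewrite !linearP. Qed.

Lemma natural_comp_mor U V W (g : FImor V W) (f : FImor U V) n m
    (a : FIhom G n m) x :
  g m (f m (Vmap U a x)) = Vmap W a (g n (f n x)).
Proof. by rewrite !mor_nat. Qed.

Definition mcomp U V W (g : FImor V W) (f : FImor U V) : FImor U W :=
  FImor_of (linear_comp_mor g f) (natural_comp_mor g f).

Lemma linear_zero_mor V W n : linear (fun _ : V n => 0 : W n).
Proof. by move=> c x y; rewrite scaler0 addr0. Qed.

Lemma natural_zero_mor V W n m (a : FIhom G n m) (x : V n) :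
  0 = Vmap W a 0.
Proof. by rewrite linear0. Qed.

Definition mzero V W : FImor V W :=
  FImor_of (@linear_zero_mor V W) (@natural_zero_mor V W).

Definition surj V W (f : FImor V W) := forall n y, exists x, f n x = y.
Definition inj V W (f : FImor V W) := forall n, injective (f n).
Definition ker V W (f : FImor V W) n (x : V n) := f n x = 0.
Definition full V n (x : V n) := True.
Definition image V W (f : FImor V W) (S : forall n, V n -> Prop) n (y : W n) :=
  exists2 x, S n x & f n x = y.

Lemma inj_ker0 V W (f : FImor V W) :
  (forall n x, f n x = 0 -> x = 0) -> inj f.
Proof.
move=> f0 n x y e; apply/eqP; rewrite -subr_eq0; apply/eqP/f0.
by rewrite linearB e subrr.
Qed.

Lemma is_submodule_ker V W (f : FImor V W) : is_submodule (ker f).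
Proof.
rewrite /ker; split=> [n|n x y fx fy|n c x fx|n m a x fx]; first exact: linear0.
- by rewrite linearD fx fy addr0.
- by rewrite linearZ /= fx scaler0.
- by rewrite mor_nat fx linear0.
Qed.

Lemma is_submodule_full V : is_submodule (@full V).
Proof. by split. Qed.

Lemma is_submodule_image V W (f : FImor V W) S :
  is_submodule S -> is_submodule (image f S).
Proof.
move=> [S0 SD SZ SA]; split=> [n|n _ _ [x Sx <-] [y Sy <-]|n c _ [x Sx <-]|
    n m a _ [x Sx <-]].
- by exists 0; rewrite ?linear0.
- by exists (x + y); rewrite ?linearD //; apply: SD.
- by exists (c *: x); rewrite ?linearZ //; apply: SZ.
- by exists (Vmap V a x); rewrite ?mor_nat //; apply: SA.
Qed.

Lemma is_submodule_preim V W (f : FImor V W) T :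
  is_submodule T -> is_submodule (fun n x => T n (f n x)).
Proof.
move=> [S0 SD SZ SA]; split=> [n|n x y Sx Sy|n c x Sx|n m a x Sx].
- by rewrite linear0.
- by rewrite linearD; apply: SD.
- by rewrite linearZ; apply: SZ.
- by rewrite mor_nat; apply: SA.
Qed.

Lemma is_submodule_cap V (S T : forall n, V n -> Prop) :
  is_submodule S -> is_submodule T -> is_submodule (fun n x => S n x /\ T n x).
Proof.
move=> [S0 SD SZ SA] [T0 TD TZ TA].
by split=> [n|n x y [Sx Tx] [Sy Ty]|n c x [Sx Tx]|n m a x [Sx Tx]]; split;
  do ?[exact: S0|exact: T0|exact: SD|exact: TD|exact: SZ|exact: TZ|exact: SA|
       exact: TA].
Qed.

Lemma submoduleB V (S : forall n, V n -> Prop) n x y :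
  is_submodule S -> S n x -> S n y -> S n (x - y).
Proof.
by move=> [S0 SD SZ SA] Sx Sy; apply: SD => //; rewrite -scaleN1r; apply: SZ.
Qed.

(** Preimages are chosen pointwise; injectivity of [e] forces the choice to be linear and
    natural. *)
Lemma lift_mono X U V (e : FImor U V) (h : FImor X V) :
  inj e -> (forall n x, exists u, e n u = h n x) ->
  exists v : FImor X U, forall n x, e n (v n x) = h n x.
Proof.
move=> e_inj he.
pose v n x := sval (cid (he n x)); have ev n x : e n (v n x) = h n x.
  exact: svalP (cid (he n x)).
have v_lin n : linear (v n).
  by move=> c x y; apply: e_inj; rewrite !linearP !ev linearP.
have v_nat n m a x : v m (Vmap X a x) = Vmap U a (v n x).
  by apply: e_inj; rewrite mor_nat !ev mor_nat.
by exists (FImor_of v_lin v_nat).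
Qed.

(** Since [h] is constant on the fibres of [q], applying it to arbitrary chosen preimages is linear
    and natural. *)
Lemma lift_epi X U V (q : FImor U V) (h : FImor U X) :
  surj q -> (forall n x, q n x = 0 -> h n x = 0) ->
  exists v : FImor V X, forall n x, v n (q n x) = h n x.
Proof.
move=> q_surj hq.
pose s n y := sval (cid (q_surj n y)); have qs n y : q n (s n y) = y.
  exact: svalP (cid (q_surj n y)).
have h_eq n x y : q n x = q n y -> h n x = h n y.
  move=> e; apply/eqP; rewrite -subr_eq0 -linearB; apply/eqP/hq.
  by rewrite linearB e subrr.
have v_lin n : linear (fun y => h n (s n y)).
  by move=> c x y; rewrite -linearP; apply: h_eq; rewrite linearP !qs.
have v_nat n m a x : h m (s m (Vmap V a x)) = Vmap X a (h n (s n x)).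
  by rewrite -mor_nat; apply: h_eq; rewrite mor_nat !qs.
by exists (FImor_of v_lin v_nat) => n x /=; apply: h_eq; rewrite qs.
Qed.

Section Sub.
Variables (V : FImod) (S : forall n, V n -> Prop) (S_sub : is_submodule S).

Definition sub_car n := {x : V n | S x}.

Lemma sub_car_eq n (x y : sub_car n) : sval x = sval y -> x = y.
Proof. by case: x y => x Sx [y Sy] /= e; apply: eq_exist. Qed.

Definition sub_zero n : sub_car n :=
  exist _ 0 (let: And4 S0 _ _ _ := S_sub in S0 n).
Definition sub_add n (x y : sub_car n) : sub_car n :=
  exist _ (sval x + sval y)
    (let: And4 _ SD _ _ := S_sub in SD n _ _ (svalP x) (svalP y)).
Definition sub_scale n (c : k) (x : sub_car n) : sub_car n :=
  exist _ (c *: sval x) (let: And4 _ _ SZ _ := S_sub in SZ n c _ (svalP x)).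
(** [is_submodule] has no clause for opposites, hence the scaling. *)
Definition sub_opp n (x : sub_car n) : sub_car n := sub_scale (-1) x.
Definition sub_map n m (a : FIhom G n m) (x : sub_car n) : sub_car m :=
  exist _ (Vmap V a (sval x))
    (let: And4 _ _ _ SA := S_sub in SA n m a _ (svalP x)).

Lemma sub_addA n : associative (@sub_add n).
Proof. by move=> x y z; apply: sub_car_eq; rewrite /= addrA. Qed.
Lemma sub_addC n : commutative (@sub_add n).
Proof. by move=> x y; apply: sub_car_eq; rewrite /= addrC. Qed.
Lemma sub_add0 n : left_id (sub_zero n) (@sub_add n).
Proof. by move=> x; apply: sub_car_eq; rewrite /= add0r. Qed.
Lemma sub_addN n : left_inverse (sub_zero n) (@sub_opp n) (@sub_add n).
Proof. by move=> x; apply: sub_car_eq; rewrite /= scaleN1r addNr. Qed.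
Lemma sub_scaleA n a b (x : sub_car n) :
  sub_scale a (sub_scale b x) = sub_scale (a * b) x.
Proof. by apply: sub_car_eq; rewrite /= scalerA. Qed.
Lemma sub_scale1 n : left_id 1 (@sub_scale n).
Proof. by move=> x; apply: sub_car_eq; rewrite /= scale1r. Qed.
Lemma sub_scaleDr n : right_distributive (@sub_scale n) (@sub_add n).
Proof. by move=> c x y; apply: sub_car_eq; rewrite /= scalerDr. Qed.
Lemma sub_scaleDl n (x : sub_car n) a b :
  sub_scale (a + b) x = sub_add (sub_scale a x) (sub_scale b x).
Proof. by apply: sub_car_eq; rewrite /= scalerDl. Qed.

Definition sub_obj n : lmodType k :=
  lmod_of (@sub_addA n) (@sub_addC n) (@sub_add0 n) (@sub_addN n)
    (@sub_scaleA n) (@sub_scale1 n) (@sub_scaleDr n) (@sub_scaleDl n).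

Lemma sub_map_linear n m (a : FIhom G n m) :
  linear (sub_map a : sub_obj n -> sub_obj m).
Proof. by move=> c x y; apply: sub_car_eq; rewrite /= linearP. Qed.

Lemma sub_map_id n (x : sub_obj n) :
  linear_of (sub_map_linear (FIid G n)) x = x.
Proof. by apply: sub_car_eq; rewrite /= Vmap_id. Qed.

Lemma sub_map_comp l n m (a : FIhom G n m) (b : FIhom G l n) (x : sub_obj l) :
  linear_of (sub_map_linear (FIcomp a b)) x =
  linear_of (sub_map_linear a) (linear_of (sub_map_linear b) x).
Proof. by apply: sub_car_eq; rewrite /= Vmap_comp. Qed.

Definition subFI : FImod := FIMod sub_map_id sub_map_comp.

Lemma sub_incl_linear n : linear (fun x : subFI n => sval x : V n).
Proof. by []. Qed.
Lemma sub_incl_nat n m (a : FIhom G n m) (x : subFI n) :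
  sval (Vmap subFI a x) = Vmap V a (sval x).
Proof. by []. Qed.
Definition sub_incl : FImor subFI V := FImor_of sub_incl_linear sub_incl_nat.

Lemma sub_incl_inj : inj sub_incl.
Proof. by move=> n x y; apply: sub_car_eq. Qed.

Lemma sub_inclP n y : S y <-> exists x, sub_incl n x = y.
Proof.
by split=> [Sy|[x <-]]; [exists (exist _ y Sy) | exact: (svalP x)].
Qed.
End Sub.

Section Quotient.
Variables (V : FImod) (S : forall n, V n -> Prop) (S_sub : is_submodule S).

(* A representative that depends only on the coset of [x] modulo [S]. *)
Definition quo_rep n (x : V n) : V n :=
  if pselect (exists y, S (x - y)) is left e then sval (cid e) else 0.

Lemma quo_repP n (x : V n) : S (x - quo_rep x).
Proof.
rewrite /quo_rep; case: pselect => [e|[]]; first exact: svalP (cid e).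
(* [x] itself is a witness, so the default 0 of [quo_rep] is never reached. *)
by exists x; rewrite subrr; case: S_sub.
Qed.

Lemma quo_rep_eq n (x y : V n) : S (x - y) -> quo_rep x = quo_rep y.
Proof.
move=> Sxy; rewrite /quo_rep.
(* The choice sees only the predicate, so equal cosets get the same representative. *)
suff -> : (fun z => S (x - z)) = (fun z => S (y - z)) by [].
have [S0 SD SZ _] := S_sub; apply: funext => z; apply: propext; split => Sz.
  by have := submoduleB S_sub Sz Sxy; rewrite opprB addrC addrA subrK.
by have := SD _ _ _ Sxy Sz; rewrite addrA subrK.
Qed.

Lemma quo_rep_sub n (x y : V n) : quo_rep x = quo_rep y -> S (x - y).
Proof.
move=> e; have := submoduleB S_sub (quo_repP x) (quo_repP y).
by rewrite e opprB addrA subrK.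
Qed.

Lemma quo_rep_id n (x : V n) : quo_rep (quo_rep x) = quo_rep x.
Proof. exact/esym/quo_rep_eq/quo_repP. Qed.

Definition quo_car n := {x : V n | quo_rep x = x}.

Definition quo_class n (x : V n) : quo_car n :=
  exist _ (quo_rep x) (quo_rep_id x).

Lemma quo_classP n (x y : V n) : quo_class x = quo_class y <-> S (x - y).
Proof.
split=> [[] /quo_rep_sub //|/quo_rep_eq e]; exact: eq_exist.
Qed.

Lemma quo_classK n (u : quo_car n) : quo_class (sval u) = u.
Proof. by case: u => x e; apply: eq_exist. Qed.

Definition quo_add n (u v : quo_car n) := quo_class (sval u + sval v).
Definition quo_scale n (c : k) (u : quo_car n) := quo_class (c *: sval u).
Definition quo_opp n (u : quo_car n) := quo_class (- sval u).
Definition quo_map n m (a : FIhom G n m) (u : quo_car n) :=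
  quo_class (Vmap V a (sval u)).

Lemma quo_repN n (x : V n) : S (quo_rep x - x).
Proof.
case: S_sub => _ _ SZ _.
by have := SZ _ (-1) _ (quo_repP x); rewrite scaleN1r opprB.
Qed.

Lemma quo_addE n (x y : V n) :
  quo_add (quo_class x) (quo_class y) = quo_class (x + y).
Proof.
apply/quo_classP => /=; rewrite opprD addrACA.
by case: S_sub => _ SD _ _; apply: SD; exact: quo_repN.
Qed.

Lemma quo_scaleE n c (x : V n) : quo_scale c (quo_class x) = quo_class (c *: x).
Proof.
apply/quo_classP => /=; rewrite -scalerBr.
by case: S_sub => _ _ SZ _; apply: SZ; exact: quo_repN.
Qed.

Lemma quo_oppE n (x : V n) : quo_opp (quo_class x) = quo_class (- x).
Proof. by apply/quo_classP; rewrite /= opprK addrC; exact: quo_repP. Qed.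

Lemma quo_mapE n m (a : FIhom G n m) x :
  quo_map a (quo_class x) = quo_class (Vmap V a x).
Proof.
apply/quo_classP => /=; rewrite -linearB.
by case: S_sub => _ _ _ SA; apply: SA; exact: quo_repN.
Qed.

Lemma quo_ind n (P : quo_car n -> Prop) :
  (forall x, P (quo_class x)) -> forall u, P u.
Proof. by move=> Px u; rewrite -(quo_classK u). Qed.

Lemma quo_addA n : associative (@quo_add n).
Proof.
elim/quo_ind=> x; elim/quo_ind=> y; elim/quo_ind=> z.
by rewrite !quo_addE addrA.
Qed.
Lemma quo_addC n : commutative (@quo_add n).
Proof. by elim/quo_ind=> x; elim/quo_ind=> y; rewrite !quo_addE addrC. Qed.
Lemma quo_add0 n : left_id (quo_class 0) (@quo_add n).
Proof. by elim/quo_ind=> x; rewrite quo_addE add0r. Qed.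
Lemma quo_addN n : left_inverse (quo_class 0) (@quo_opp n) (@quo_add n).
Proof. by elim/quo_ind=> x; rewrite quo_oppE quo_addE addNr. Qed.
Lemma quo_scaleA n a b (u : quo_car n) :
  quo_scale a (quo_scale b u) = quo_scale (a * b) u.
Proof. by elim/quo_ind: u => x; rewrite !quo_scaleE scalerA. Qed.
Lemma quo_scale1 n : left_id 1 (@quo_scale n).
Proof. by elim/quo_ind=> x; rewrite quo_scaleE scale1r. Qed.
Lemma quo_scaleDr n : right_distributive (@quo_scale n) (@quo_add n).
Proof.
move=> c; elim/quo_ind=> x; elim/quo_ind=> y.
by rewrite quo_addE !quo_scaleE quo_addE scalerDr.
Qed.
Lemma quo_scaleDl n (u : quo_car n) a b :
  quo_scale (a + b) u = quo_add (quo_scale a u) (quo_scale b u).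
Proof. by elim/quo_ind: u => x; rewrite !quo_scaleE quo_addE scalerDl. Qed.

Definition quo_obj n : lmodType k :=
  lmod_of (@quo_addA n) (@quo_addC n) (@quo_add0 n) (@quo_addN n)
    (@quo_scaleA n) (@quo_scale1 n) (@quo_scaleDr n) (@quo_scaleDl n).

Lemma quo_class_linear n : linear (@quo_class n : V n -> quo_obj n).
Proof. by move=> c x y; rewrite -quo_addE -quo_scaleE. Qed.

Lemma quo_map_linear n m (a : FIhom G n m) :
  linear (quo_map a : quo_obj n -> quo_obj m).
Proof.
move=> c; elim/quo_ind=> x; elim/quo_ind=> y.
by rewrite -quo_class_linear !quo_mapE linearP -quo_class_linear.
Qed.

Lemma quo_map_id n (x : quo_obj n) :
  linear_of (quo_map_linear (FIid G n)) x = x.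
Proof. by elim/quo_ind: x => x; rewrite /= quo_mapE Vmap_id. Qed.

Lemma quo_map_comp l n m (a : FIhom G n m) (b : FIhom G l n) (x : quo_obj l) :
  linear_of (quo_map_linear (FIcomp a b)) x =
  linear_of (quo_map_linear a) (linear_of (quo_map_linear b) x).
Proof. by elim/quo_ind: x => x; rewrite /= !quo_mapE Vmap_comp. Qed.

Definition quoFI : FImod := FIMod quo_map_id quo_map_comp.

Lemma quo_proj_nat n m (a : FIhom G n m) (x : V n) :
  quo_class (Vmap V a x) = Vmap quoFI a (quo_class x).
Proof. by rewrite /= quo_mapE. Qed.

Definition quo_proj : FImor V quoFI :=
  FImor_of (W := quoFI) (f := quo_class) quo_class_linear quo_proj_nat.

Lemma quo_proj_surj : surj quo_proj.
Proof. by move=> n; elim/quo_ind=> x; exists x. Qed.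

Lemma quo_proj_eq0 n x : quo_proj n x = 0 <-> S x.
Proof. by rewrite -[x in S x]subr0; exact: quo_classP. Qed.
End Quotient.

Lemma exists_sub V (S : forall n, V n -> Prop) : is_submodule S ->
  exists K (e : FImor K V), inj e /\ forall n y, S n y <-> exists x, e n x = y.
Proof.
move=> S_sub; exists (subFI S_sub), (sub_incl S_sub).
by split=> [|n y]; [exact: sub_incl_inj | exact: sub_inclP].
Qed.

Lemma exists_quo V (S : forall n, V n -> Prop) : is_submodule S ->
  exists Q (q : FImor V Q), surj q /\ forall n x, q n x = 0 <-> S n x.
Proof.
move=> S_sub; exists (quoFI S_sub), (quo_proj S_sub).
by split=> [|n y]; [exact: quo_proj_surj | exact: quo_proj_eq0].
Qed.

End Submodules.

(** * Generation in finite degree and finite presentation *)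

Section FinitePresentation.
Variables (G : group) (k : comPzRingType).
Local Notation FImod := (FImod G k).
Implicit Types U V W X : FImod.

(** Generation is tested against submodules of the ambient [V], so [S] need not be turned into a
    module; [fg_embedded] relates this to [gen_fin_deg]. *)
Definition gen_in V (S : forall n, V n -> Prop) (N : nat) :=
  forall T, is_submodule T ->
    (forall n, (n <= N)%N -> forall x, S n x -> T n x) ->
    forall n x, S n x -> T n x.

Definition fg V (S : forall n, V n -> Prop) := exists N, gen_in S N.

Lemma fg_full V : gen_fin_deg V <-> fg (@full G k V).
Proof.
split=> -[N gN]; exists N => T Tsub TN.
  by move=> n x _; apply: (gN T) => // m le y; apply: TN.
by move=> n x; apply: (gN T) => // m le y _; apply: TN.
Qed.

Lemma fg_eq V (S T : forall n, V n -> Prop) :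
  (forall n x, S n x <-> T n x) -> fg S -> fg T.
Proof.
move=> ST [N gN]; exists N => R Rsub TR n x /ST.
by apply: gN => // m le y /ST; apply: TR.
Qed.

Lemma fg_image U V (f : FImor U V) S : fg S -> fg (image f S).
Proof.
move=> [N gN]; exists N => T Tsub TN n _ [x Sx <-].
apply: (gN _ (is_submodule_preim f Tsub)) Sx => m le y Sy.
by apply: TN => //; exists y.
Qed.

Lemma fg_image_inj U V (e : FImor U V) S : inj e -> fg (image e S) -> fg S.
Proof.
move=> e_inj [N gN]; exists N => T Tsub TN n x Sx.
have [||y Ty /e_inj <- //] := gN _ (is_submodule_image e Tsub) _ n (e n x).
  by move=> m le _ [y Sy <-]; exists y => //; apply: TN.
by exists x.
Qed.

(** Above the image bound, each [x] in [S] has the same image as some [y] in both [S] and [T]; the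
    difference lies in the kernel, where the other bound applies. *)
Lemma fg_ext U V (f : FImor U V) S : is_submodule S ->
  fg (fun n x => S n x /\ f n x = 0) -> fg (image f S) -> fg S.
Proof.
move=> Ssub [M gM] [N gN]; exists (maxn M N) => T Tsub TS n x Sx.
have STsub := is_submodule_cap Ssub Tsub.
have [||y [Sy Ty] e] := gN _ (is_submodule_image f STsub) _ n (f n x).
- move=> m le _ [y Sy <-]; exists y => //; split=> //.
  by apply: TS => //; rewrite leq_max le orbT.
- by exists x.
rewrite -[x](subrK y); case: (Tsub) => _ TD _ _; apply: TD => //.
apply: (gM _ Tsub).
  by move=> m le z [Sz _]; apply: TS => //; rewrite leq_max le.
by split; [exact: submoduleB | rewrite linearB e subrr].
Qed.

Lemma fg_embedded K V (e : FImor K V) (S : forall n, V n -> Prop) :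
  inj e -> (forall n y, S n y <-> exists x, e n x = y) ->
  gen_fin_deg K <-> fg S.
Proof.
move=> e_inj eS; have E n y : image e (@full G k K) y <-> S n y.
  by rewrite eS; split=> [[x _ <-]|[x <-]]; exists x.
rewrite fg_full; split=> [/(fg_image e) /(fg_eq E) //|gS].
by apply: (fg_image_inj e_inj); apply: fg_eq gS => n y; rewrite E.
Qed.

Lemma gen_surj U V (f : FImor U V) : surj f -> gen_fin_deg U -> gen_fin_deg V.
Proof.
move=> fs /fg_full/(fg_image f) gV; apply/fg_full; apply: fg_eq gV => n y.
by split=> // _; have [x <-] := fs n y; exists x.
Qed.

Lemma gen_ext U V (f : FImor U V) :
  fg (ker f) -> gen_fin_deg V -> surj f -> gen_fin_deg U.
Proof.
move=> gk /fg_full gV fs; apply/fg_full; apply: (fg_ext (f := f)).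
- exact: is_submodule_full.
- by apply: fg_eq gk => n x; split=> [|[]].
- apply: fg_eq gV => n y; split=> // _.
  by have [x <-] := fs n y; exists x.
Qed.

(* The analogue of finite presentation; unlike [dw_coherent] it does not
   mention free modules, so it is transported along exact sequences by diagram
   chases alone. *)
Definition FP V := gen_fin_deg V /\
  forall U (f : FImor U V), surj f -> gen_fin_deg U -> fg (ker f).

(** * Binary direct sums *)

Lemma prod_map_linear U V n m (a : FIhom G n m) :
  linear (fun p : (U n * V n)%type =>
            (Vmap U a p.1, Vmap V a p.2) : (U m * V m)%type).
Proof. by move=> c x y; rewrite /= !linearP. Qed.

Lemma prod_map_id U V n (p : (U n * V n)%type) :
  linear_of (@prod_map_linear U V n n (FIid G n)) p = p.
Proof. by case: p => x y /=; rewrite !Vmap_id. Qed.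

Lemma prod_map_comp U V l n m (a : FIhom G n m) (b : FIhom G l n)
    (p : (U l * V l)%type) :
  linear_of (@prod_map_linear U V l m (FIcomp a b)) p =
  linear_of (@prod_map_linear U V n m a) (linear_of (prod_map_linear b) p).
Proof. by rewrite /= !Vmap_comp. Qed.

Definition prodFI U V : FImod := FIMod (@prod_map_id U V) (@prod_map_comp U V).

Lemma pfst_linear U V n : linear (fun p : prodFI U V n => p.1).
Proof. by []. Qed.
Definition pfst U V : FImor (prodFI U V) U :=
  FImor_of (@pfst_linear U V) (fun n m a x => erefl).

Lemma psnd_linear U V n : linear (fun p : prodFI U V n => p.2).
Proof. by []. Qed.
Definition psnd U V : FImor (prodFI U V) V :=
  FImor_of (@psnd_linear U V) (fun n m a x => erefl).

Lemma pinl_linear U V n : linear (fun x : U n => (x, 0) : prodFI U V n).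
Proof. by move=> c x y; congr pair; rewrite /= scaler0 addr0. Qed.
Lemma pinl_nat U V n m (a : FIhom G n m) x :
  (Vmap U a x, 0) = Vmap (prodFI U V) a (x, 0).
Proof. by rewrite /= linear0. Qed.
Definition pinl U V : FImor U (prodFI U V) :=
  FImor_of (@pinl_linear U V) (@pinl_nat U V).

Lemma pinr_linear U V n : linear (fun y : V n => (0, y) : prodFI U V n).
Proof. by move=> c x y; congr pair; rewrite /= scaler0 addr0. Qed.
Lemma pinr_nat U V n m (a : FIhom G n m) y :
  (0, Vmap V a y) = Vmap (prodFI U V) a (0, y).
Proof. by rewrite /= linear0. Qed.
Definition pinr U V : FImor V (prodFI U V) :=
  FImor_of (@pinr_linear U V) (@pinr_nat U V).

(* Given [g : U -> V], compare through the pullback of [f] and [g]. *)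
Lemma FP_quotient F V (f : FImor F V) :
  surj f -> fg (ker f) -> FP F -> FP V.
Proof.
move=> fs gk [gF FPF]; split; first exact: gen_surj gF.
move=> U g gs gU.
pose S n (p : prodFI U F n) := g n p.1 = f n p.2.
have Ssub : is_submodule S.
  rewrite /S; split=> [n|n x y ex ey|n c x ex|n m a x ex] /=.
  - by rewrite !linear0.
  - by rewrite !linearD ex ey.
  - by rewrite !linearZ /= ex.
  - by rewrite !mor_nat ex.
(* The pullback is an extension of [U] by the kernel of [f]. *)
have gS : fg S.
  apply: (fg_ext (f := pfst U F)) => //.
    apply: fg_eq (fg_image (pinr U F) gk) => n [u x]; rewrite /S /=; split.
      by move=> [y fy [<- <-]]; rewrite fy linear0.
    by move=> [e u0]; exists x; rewrite ?u0 // /ker -e u0 linear0.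
  apply: fg_eq (proj1 (fg_full U) gU) => n u; split=> // _.
  by have [x ex] := fs n (g n u); exists (u, x).
have [Q [e [e_inj eS]]] := exists_sub Ssub.
have gQ : gen_fin_deg Q by apply/(fg_embedded e_inj eS).
have ps : surj (mcomp (psnd U F) e).
  move=> n x; have [u gu] := gs n (f n x).
  have [|q eq] := proj1 (eS n (u, x)); first exact: gu.
  by exists q; rewrite /= eq.
(* The kernel of the projection to [F] consists of the pairs with second entry 0, and its first
   entries form the kernel of [g]. *)
have := fg_image (mcomp (pfst U F) e) (FPF _ _ ps gQ).
apply: fg_eq => n u; rewrite /ker; split=> [[q q0 <-]|gu0].
  have := proj2 (eS n (e n q)) (ex_intro _ q erefl).
  by rewrite /S /= => ->; move: q0 => /= ->; rewrite linear0.
have [|q eq] := proj1 (eS n (u, 0)); first by rewrite /S /= linear0.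
by exists q; rewrite /= eq.
Qed.

(** For [g] from [X] onto [U], the kernel of [f] after [g] is generated in finite degree because [V]
    is FP. It maps onto [K] with kernel that of [g], so FP for [K] concludes. *)
Lemma FP_extension K U V (e : FImor K U) (f : FImor U V) :
  inj e -> (forall n x, f n x = 0 <-> exists y, e n y = x) -> surj f ->
  FP K -> FP V -> FP U.
Proof.
move=> e_inj ex fs [gK FPK] [gV FPV].
have gU : gen_fin_deg U.
  by apply: gen_ext fs => //; apply/(fg_embedded e_inj).
split=> // X g gs gX.
have fgs : surj (mcomp f g).
  by move=> n y; have [u <-] := fs n y; have [x <-] := gs n u; exists x.
have gker := FPV _ _ fgs gX.
have [Y [i [i_inj iY]]] := exists_sub (is_submodule_ker (mcomp f g)).
have gY : gen_fin_deg Y by apply/(fg_embedded i_inj iY).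
have [|h eh] := @lift_mono _ _ Y K U e (mcomp g i) e_inj.
  move=> n y; apply/ex; rewrite /=; apply: (proj2 (iY n _)); by exists y.
have hs : surj h.
  move=> n z; have [x gx] := gs n (e n z).
  have [|y iy] := proj1 (iY n x).
    by rewrite /ker /= gx; apply/ex; exists z.
  by exists y; apply: e_inj; rewrite eh /= iy.
apply: fg_eq (fg_image i (FPK _ _ hs gY)) => n x; rewrite /ker.
split=> [[y hy <-]|gx].
  by have := eh n y; rewrite hy linear0 => /esym.
have [|y iy] := proj1 (iY n x); first by rewrite /ker /= gx linear0.
by exists y => //; apply: e_inj; rewrite eh /= iy gx linear0.
Qed.

(** A morphism crossing from degree at most [L] to degree above [L] passes through degree [L.+1]:
    split off standard inclusions one at a time. *)
Lemma Vmap_iota_closed V (T : forall n, V n -> Prop) L :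
  is_submodule T -> (forall x : V L.+1, T L.+1 x) ->
  forall n m (a : FIhom G n m) x, (n <= L)%N -> (L < m)%N -> T m (Vmap V a x).
Proof.
move=> [_ _ _ TA] TL n m a x leL ltm.
have [j] := ubnP (L - n)%N; elim: j => // j IH in n a x leL *.
have [b ->] := FI_factor_iota a (leq_ltn_trans leL ltm).
rewrite ltnS Vmap_comp => lej; case: (ltngtP n L) leL => // [ltL|e] _.
  by apply: IH => //; apply: leq_trans lej; rewrite ltn_sub2l.
by apply: TA; move: x b; rewrite e => x b; exact: TL.
Qed.

Lemma FP_bounded V N : (forall n (x : V n), (N < n)%N -> x = 0) -> FP V.
Proof.
move=> V0; split.
  exists N => T [T0 _ _ _] TN n x; case: (leqP n N) => [le|lt]; first exact: TN.
  by rewrite (V0 n x lt).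
move=> U f fs [M gM]; pose L := maxn M N.
exists L.+1 => T Tsub TL; have [T0 TD TZ TA] := Tsub.
have kerL n (x : U n) : (L < n)%N -> f n x = 0.
  by move=> ltL; apply: V0; apply: leq_ltn_trans ltL; rewrite leq_maxr.
have TL1 (x : U L.+1) : T L.+1 x by apply: TL => //; apply: kerL.
(* Vacuous up to degree [L], so [T'] contains the generators of [U]. *)
pose T' n (x : U n) := (L < n)%N -> T n x.
have T'sub : is_submodule T'.
  rewrite /T'; split=> [n _|n x y Tx Ty lt|n c x Tx lt|n m a x Tx lt].
  - exact: T0.
  - by apply: TD; [exact: Tx | exact: Ty].
  - by apply: TZ; exact: Tx.
  - case: (ltnP L n) => [ltn|len]; first by apply: TA; exact: Tx.
    exact: (Vmap_iota_closed Tsub TL1).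
have T'all : forall n x, T' n x.
  apply: gM => // n leM x lt; have : (n <= L)%N by rewrite leq_max leM.
  by rewrite leqNgt lt.
move=> n x kx; case: (leqP n L) => [le|/T'all //].
by apply: TL => //; apply: leqW.
Qed.

(** The elements that vanish if their degree exceeds [N] form a submodule: any map across [N]
    factors through a standard inclusion, which acts by 0. *)
Lemma gen_killed_bounded V :
  gen_fin_deg V -> (forall n x, Vmap V (FIiota G n) x = 0) ->
  exists N, forall n (x : V n), (N < n)%N -> x = 0.
Proof.
move=> [N gN] V0; exists N; apply: gN => [|n le x]; last by rewrite ltnNge le.
split=> [//|n x y x0 y0 lt|n c x x0 lt|n m a x x0 lt].
- by rewrite x0 // y0 // addr0.
- by rewrite x0 // scaler0.
- case: (ltnP N n) => [/x0 ->|le]; first exact: linear0.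
  have [b ->] := FI_factor_iota a (leq_ltn_trans le lt).
  by rewrite Vmap_comp V0 linear0.
Qed.

End FinitePresentation.

(** * The shift functor and the derivative *)

Section Shift.
Variables (G : group) (k : comPzRingType).
Local Notation FImod := (FImod G k).
Implicit Types U V W X F K : FImod.

Lemma shift_id V n x : Vmap V (FIup (FIid G n)) x = x.
Proof. by rewrite FIup_id Vmap_id. Qed.

Lemma shift_comp V l n m (a : FIhom G n m) (b : FIhom G l n) x :
  Vmap V (FIup (FIcomp a b)) x = Vmap V (FIup a) (Vmap V (FIup b) x).
Proof. by rewrite FIup_comp Vmap_comp. Qed.

Definition shift V : FImod :=
  @FIMod G k (fun n => V n.+1) (fun n m a => Vmap V (FIup a))
    (@shift_id V) (@shift_comp V).

Definition shift_mor V W (f : FImor V W) : FImor (shift V) (shift W) :=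
  @FIMor G k (shift V) (shift W) (fun n => f n.+1)
    (fun n m a x => mor_nat f (FIup a) x).

Lemma to_shift_nat V n m (a : FIhom G n m) x :
  Vmap V (FIiota G m) (Vmap V a x) = Vmap (shift V) a (Vmap V (FIiota G n) x).
Proof. by rewrite /= -!Vmap_comp FIup_iota. Qed.

Definition to_shift V : FImor V (shift V) :=
  @FIMor G k V (shift V) (fun n => Vmap V (FIiota G n)) (@to_shift_nat V).

Definition is_derivative V D (p : FImor (shift V) D) :=
  surj p /\ forall n x, p n x = 0 <-> exists y, to_shift V n y = x.

Lemma exists_derivative V : exists D (p : FImor (shift V) D), is_derivative p.
Proof.
have [D [p [ps pE]]] :=
  exists_quo (is_submodule_image (to_shift V) (is_submodule_full V)).
exists D, p; split=> // n x; rewrite pE.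
by split=> [[y _ <-]|[y <-]]; exists y.
Qed.

(** By [FI_split], a generator of [V] moved into the shift either comes from [V], and dies in [D],
    or is moved by [FIup b] from degree [n.-1] of the shift. *)
Lemma gen_derivative V D (p : FImor (shift V) D) :
  is_derivative p -> gen_fin_deg V -> gen_fin_deg D.
Proof.
move=> [ps pE] [N gN]; exists N => T Tsub TN; have [T0 TD TZ TA] := Tsub.
pose T' n (x : V n) := forall m (a : FIhom G n m.+1), T m (p m (Vmap V a x)).
have T'all : forall n x, T' n x.
  apply: gN => [|n le x m a].
    rewrite /T'; split=> [n m a|n x y Tx Ty m a|n c x Tx m a|n m b x Tx l a].
    - by rewrite !linear0.
    - by rewrite !linearD; apply: TD.
    - by rewrite !linearZ_LR; apply: TZ.
    - by rewrite -Vmap_comp.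
  have [[b ->]|[y [g [b ->]]]] := FI_split a.
    suff -> : p m (Vmap V (FIcomp (FIiota G m) b) x) = 0 by [].
    by apply/pE; exists (Vmap V b x); rewrite /= Vmap_comp.
  rewrite Vmap_comp.
  have -> : Vmap V (FIup b) (Vmap V (FIpoint y g) x) =
            Vmap (shift V) b (Vmap V (FIpoint y g) x) by [].
  rewrite mor_nat; apply: TA; apply: TN.
  by apply: leq_trans le; exact: leq_pred.
move=> n d; have [x <-] := ps n d.
by have := T'all _ x n (FIid G n.+1); rewrite Vmap_id.
Qed.

(** A snake argument: the shifted kernel of [f] maps onto the kernel of the induced map [g] of
    derivatives. Generators of the latter lift, and the remaining error comes from one degree
    lower. *)
Lemma FP_of_derivative V D (p : FImor (shift V) D) :
  is_derivative p -> inj (to_shift V) -> gen_fin_deg V -> FP D -> FP V.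
Proof.
move=> [ps pE] V_inj gV [gD FPD]; split=> // U f fs gU.
have [E [q [qs qE]]] := exists_derivative U.
have [|g ge] := lift_epi (q := q) (h := mcomp p (shift_mor f)) qs.
  move=> n x /qE[y <-]; apply/pE; exists (f n y).
  by rewrite /= mor_nat.
have gs : surj g.
  move=> n d; have [v <-] := ps n d; have [u <-] := fs n.+1 v.
  by exists (q n u); rewrite ge.
have [N gN] := FPD _ _ gs (gen_derivative (conj qs qE) gU).
(* Degree [N] of the shift is degree [N.+1] of [U]. *)
exists N.+1 => T Tsub TN.
have Xsub := is_submodule_cap (is_submodule_ker f) Tsub.
pose T' n (e : E n) := exists2 x : U n.+1, ker f x /\ T n.+1 x & q n x = e.
have T'sub : is_submodule T'.
  have [X0 XD XZ XA] := Xsub.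
  split=> [n|n _ _ [x Xx <-] [y Xy <-]|n c _ [x Xx <-]|n m a _ [x Xx <-]].
  - by exists 0; [exact: X0 | rewrite linear0].
  - by exists (x + y); [exact: XD | rewrite linearD].
  - by exists (c *: x); [exact: XZ | rewrite linearZ].
  - by exists (Vmap (shift U) a x); [exact: XA | rewrite mor_nat].
have T'ker : forall n e, ker g e -> T' n e.
  apply: gN => // n le e; have [u <-] := qs n e.
  rewrite /ker ge => /pE[v]; have [u' <-] := fs n v.
  rewrite /= -mor_nat => /eqP; rewrite eq_sym -subr_eq0 -linearB => /eqP k0.
  (* Subtracting an element that dies in [E] moves [u] into the kernel of [f] without changing its
     class. *)
  exists (u - Vmap U (FIiota G n) u'); first by split=> //; apply: TN.
  rewrite linearB; have -> : q n (Vmap U (FIiota G n) u') = 0.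
    by apply/qE; exists u'.
  by rewrite subr0.
elim=> [|n IH] x kx; first exact: TN.
have [|x' [kx' Tx'] e] := T'ker n (q n x).
  by rewrite /ker ge /=; rewrite kx linear0.
have /qE[u' eu] : q n (x - x') = 0 by rewrite linearB e subrr.
have [_ TD _ TA] := Tsub.
rewrite -[x](subrK x'); apply: TD => //; rewrite -eu; apply: TA; apply: IH.
(* Injectivity of [to_shift V] puts [u'] in the kernel of [f], so the induction hypothesis covers
   it. *)
apply: V_inj; rewrite linear0 /= -mor_nat.
by move: eu => /= ->; rewrite linearB kx kx' subrr.
Qed.

(** The kernel condition says that [phi] embeds the derivative of [F] in [F']; an embedding is
    enough, so the derivative need not be computed. *)
Fixpoint good d F : Prop :=
  if d is d'.+1 then
    inj (to_shift F) /\ exists F' (phi : FImor (shift F) F'),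
      (forall n x, phi n x = 0 <-> exists y, to_shift F n y = x) /\ good d' F'
  else forall n (x : F n), x = 0.

(* Induction on [d]: the derivative of [K] is an extension of its image in
   [F'], which is FP by induction, by the kernel; the latter is generated in
   finite degree and killed by the standard inclusions, hence bounded. *)
Lemma good_sub_FP d F K (e : FImor K F) :
  good d F -> inj e -> gen_fin_deg K -> FP K.
Proof.
elim: d F K e => [|d IH] F K e /=.
  move=> F0 e_inj _; apply: (FP_bounded (N := 0)) => n x _.
  by apply: e_inj; rewrite linear0; apply: F0.
move=> [F_inj [F' [phi [phiE gF']]]] e_inj gK.
have [D [p [ps pE]]] := exists_derivative K.
have gD := gen_derivative (conj ps pE) gK.
have K_inj : inj (to_shift K).
  move=> n x y exy; apply: e_inj; apply: F_inj.
  by rewrite /= -!mor_nat; congr (e _ _); exact: exy.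
apply: (FP_of_derivative (conj ps pE)) => //.
have [|f fE] := lift_epi (q := p) (h := mcomp phi (shift_mor e)) ps.
  by move=> n x /pE[y <-]; apply/phiE; exists (e n y); rewrite /= mor_nat.
have [I [i [i_inj iI]]] :=
  exists_sub (is_submodule_image f (is_submodule_full D)).
have [|g gE] := lift_mono (e := i) (h := f) i_inj.
  by move=> n x; apply/iI; exists x.
have gs : surj g.
  move=> n y; have [|x _ fx] := proj2 (iI n (i n y)); first by exists y.
  by exists x; apply: i_inj; rewrite gE.
have FPI : FP I by apply: (IH _ _ i gF' i_inj); exact: gen_surj gs gD.
have gker : fg (ker g) by case: FPI => _ FPI; exact: FPI.
have [Q [j [j_inj jQ]]] := exists_sub (is_submodule_ker g).
have gQ : gen_fin_deg Q by apply/(fg_embedded j_inj jQ).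
have [|N QN] := gen_killed_bounded gQ.
  move=> n y; apply: j_inj; rewrite linear0 mor_nat.
  have : ker g (j n y) by apply/jQ; exists y.
  have [x <-] := ps n (j n y); rewrite /ker => g0.
  have := gE n (p n x); rewrite g0 linear0 fE => /esym /phiE[z ez].
  (* As [e x] comes from [z] by a standard inclusion, [FIup (FIiota G n)] and [FIiota G n.+1] agree
     on it. So the translate of [x] lies in the image of [to_shift K] and dies in [D]. *)
  rewrite -mor_nat; apply/pE; exists x; apply: e_inj.
  by rewrite /= !mor_nat -[e _ x]ez /= -!Vmap_comp FIup_iota.
exact: (FP_extension j_inj jQ gs (FP_bounded QN) FPI).
Qed.

Lemma good_embed d F F' (e : FImor F F') : inj e -> good d F' ->
  forall K (i : FImor K F), inj i -> gen_fin_deg K -> FP K.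
Proof.
move=> e_inj gF' K i i_inj; apply: (good_sub_FP (e := mcomp e i)) gF' _.
by move=> n x y /e_inj /i_inj.
Qed.

(** * Free modules *)

Lemma free_gen F : free_fin_gen F -> gen_fin_deg F.
Proof.
move=> [d [I [r [W [j [rd jW univ]]]]]]; exists d => T Tsub TN.
have [Q [q [qs qE]]] := exists_quo Tsub.
have t_lin i : linear (fun _ : W i => 0 : Q (r i)).
  by move=> c x y; rewrite scaler0 addr0.
have [|u [_ uu]] := univ Q (fun i => linear_of (t_lin i)).
  by move=> i a w; rewrite /= linear0.
(* The projection and the zero map agree on the generators, hence everywhere. *)
move=> n x; apply/qE; rewrite (uu q).
  by rewrite -(uu (mzero F Q)).
by move=> i w; apply/qE; apply: TN.
Qed.

(** The modules [W i] need not be projective, so [f] need not split. After dividing [U] by the part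
    of the kernel in [T], the induced [h] is injective up to degree [N]; generators then lift
    uniquely, hence equivariantly, and the lift inverts [h]. *)
Lemma free_FP F : free_fin_gen F -> FP F.
Proof.
move=> freeF; split; first exact: free_gen.
move: freeF => [d [I [r [W [j [rd jW univ]]]]]] U f fs [M gM].
pose N := maxn M d; exists N => T Tsub TN.
pose S n x := ker f x /\ T n x.
have Ssub : is_submodule S := is_submodule_cap (is_submodule_ker f) Tsub.
have [Q [q [qs qE]]] := exists_quo Ssub.
have [|h hE] := lift_epi (q := q) (h := f) qs; first by move=> n x /qE[].
have h_inj n : (n <= N)%N -> injective (h n).
  move=> le x y; have [u <-] := qs n x; have [v <-] := qs n y.
  rewrite !hE => e; apply/eqP; rewrite -subr_eq0 -linearB; apply/eqP/qE.
  have ku : ker f (u - v) by rewrite /ker linearB e subrr.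
  by split=> //; apply: TN.
have hs : surj h.
  by move=> n y; have [x <-] := fs n y; exists (q n x); rewrite hE.
pose s n y := sval (cid (hs n y)); have hsK n y : h n (s n y) = y.
  exact: svalP (cid (hs n y)).
have leN i : (r i <= N)%N by rewrite leq_max rd orbT.
have t_lin i : linear (fun w : W i => s (r i) (j i w)).
  by move=> c x y; apply: (h_inj _ (leN i)); rewrite [RHS]linearP !hsK linearP.
have [|u [uE _]] := univ Q (fun i => linear_of (t_lin i)).
  move=> i a w; apply: (h_inj _ (leN i)) => /=.
  by rewrite mor_nat !hsK jW.
have huK n y : h n (u n y) = y.
  have [|v [_ vu]] := univ F j; first exact: jW.
  have -> : h n (u n y) = v n y.
    by apply: (vu (mcomp h u)) => i w; rewrite /= uE /= hsK.
  by symmetry; apply: (vu (FImor_of (f := fun n x => x) (fun n c x y => erefl)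
    (fun n m a x => erefl))).
have uhK : forall n x, u n (h n (q n x)) = q n x.
  apply: gM => [|n le x]; last first.
    by apply: h_inj; [exact: leq_trans le (leq_maxl _ _) | exact: huK].
  split=> [n|n x y ex ey|n c x ex|n m a x ex].
  - by rewrite !linear0.
  - by rewrite !linearD ex ey.
  - by rewrite !linearZ_LR ex.
  - by rewrite !mor_nat ex.
move=> n x kx; suff /qE[] : q n x = 0 by [].
by rewrite -uhK hE kx linear0.
Qed.

End Shift.

(** * Modules of functions on Hom sets *)

Section FunctionModule.
Variables (G : group) (k : comPzRingType) (I : Type) (r : I -> nat).
Variable W : I -> lmodType k.

(** Neither finite support nor equivariance is imposed: these modules only serve as [good] ambient
    modules, and an infinite [G] does no harm. *)
Definition fun_car n := forall i, FIhom G (r i) n -> W i.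

Lemma fun_car_eq n (f g : fun_car n) : (forall i h, f i h = g i h) -> f = g.
Proof.
by move=> e; do 2!(apply: functional_extensionality_dep => ?); exact: e.
Qed.

Definition fun_zero n : fun_car n := fun _ _ => 0.
Definition fun_add n (f g : fun_car n) : fun_car n := fun i h => f i h + g i h.
Definition fun_opp n (f : fun_car n) : fun_car n := fun i h => - f i h.
Definition fun_scale n (c : k) (f : fun_car n) : fun_car n :=
  fun i h => c *: f i h.

Lemma fun_addA n : associative (@fun_add n).
Proof. by move=> f g e; apply: fun_car_eq => i h; rewrite /fun_add addrA. Qed.
Lemma fun_addC n : commutative (@fun_add n).
Proof. by move=> f g; apply: fun_car_eq => i h; rewrite /fun_add addrC. Qed.
Lemma fun_add0 n : left_id (@fun_zero n) (@fun_add n).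
Proof. by move=> f; apply: fun_car_eq => i h; rewrite /fun_add add0r. Qed.
Lemma fun_addN n : left_inverse (@fun_zero n) (@fun_opp n) (@fun_add n).
Proof. by move=> f; apply: fun_car_eq => i h; rewrite /fun_add addNr. Qed.
Lemma fun_scaleA n a b (f : fun_car n) :
  fun_scale a (fun_scale b f) = fun_scale (a * b) f.
Proof. by apply: fun_car_eq => i h; rewrite /fun_scale scalerA. Qed.
Lemma fun_scale1 n : left_id 1 (@fun_scale n).
Proof. by move=> f; apply: fun_car_eq => i h; rewrite /fun_scale scale1r. Qed.
Lemma fun_scaleDr n : right_distributive (@fun_scale n) (@fun_add n).
Proof.
by move=> c f g; apply: fun_car_eq => i h; rewrite /fun_scale scalerDr.
Qed.
Lemma fun_scaleDl n (f : fun_car n) a b :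
  fun_scale (a + b) f = fun_add (fun_scale a f) (fun_scale b f).
Proof. by apply: fun_car_eq => i h; rewrite /fun_scale scalerDl. Qed.

Definition fun_obj n : lmodType k :=
  lmod_of (@fun_addA n) (@fun_addC n) (@fun_add0 n) (@fun_addN n)
    (@fun_scaleA n) (@fun_scale1 n) (@fun_scaleDr n) (@fun_scaleDl n).

Lemma fun_lcE n c (f g : fun_obj n) i h :
  (c *: f + g : fun_obj n) i h = c *: f i h + g i h.
Proof. by []. Qed.

(* Extension by zero along [h |-> FIcomp a h], which is injective. *)
Definition push n m (a : FIhom G n m) (f : fun_car n) : fun_car m :=
  fun i h => if pselect (exists h', h = FIcomp a h') is left e
             then f i (sval (cid e)) else 0.

Lemma push_in n m (a : FIhom G n m) f i h : push a f (FIcomp a h) = f i h.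
Proof.
rewrite /push; case: pselect => [e|[]]; last by exists h.
by congr (f i); apply/esym/(@FIcompI _ _ _ _ a); exact: svalP (cid e).
Qed.

Lemma push_out n m (a : FIhom G n m) f i (h : FIhom G (r i) m) :
  ~ (exists h', h = FIcomp a h') -> push a f h = 0.
Proof. by move=> ne; rewrite /push; case: pselect. Qed.

Lemma push_linear n m (a : FIhom G n m) :
  linear (push a : fun_obj n -> fun_obj m).
Proof.
move=> c f g; apply: fun_car_eq => i h.
rewrite fun_lcE /=.
case: (pselect (exists h', h = FIcomp a h')) => [[h' ->]|ne].
  by rewrite !push_in.
by rewrite !push_out // scaler0 addr0.
Qed.

Lemma push_id n (f : fun_obj n) : linear_of (push_linear (FIid G n)) f = f.
Proof.
by apply: fun_car_eq => i h; rewrite /= -{1}(FIcomp1l h) push_in.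
Qed.

Lemma push_comp l n m (a : FIhom G n m) (b : FIhom G l n) (f : fun_obj l) :
  linear_of (push_linear (FIcomp a b)) f =
  linear_of (push_linear a) (linear_of (push_linear b) f).
Proof.
apply: fun_car_eq => i h /=.
case: (pselect (exists h', h = FIcomp a h')) => [[h' ->]|ne]; last first.
  rewrite !push_out // => -[h' e]; apply: ne.
  by exists (FIcomp b h'); rewrite FIcompA.
rewrite push_in; case: (pselect (exists h, h' = FIcomp b h)) => [[h'' ->]|ne].
  by rewrite FIcompA !push_in.
rewrite !push_out // => -[h'' e]; apply: ne; exists h''.
by apply: (@FIcompI _ _ _ _ a); rewrite FIcompA.
Qed.

Definition funFI : FImod G k := FIMod push_id push_comp.

Lemma to_shift_fun_inj : inj (to_shift funFI).
Proof.
move=> n f g e; apply: fun_car_eq => i h.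
by have := congr1 (fun f : fun_car n.+1 => f i (FIcomp (FIiota G n) h)) e;
  rewrite /= !push_in.
Qed.

End FunctionModule.

(** * Derivatives of function modules *)

Section FunctionModuleDerivative.
Variables (G : group) (k : comPzRingType).

Lemma FIpoint_iota n (x : 'I_n) (g : G) m (h : FIhom G n.-1 m) b :
  FIcomp (FIup h) (FIpoint x g) <> FIcomp (FIiota G m) b.
Proof.
move=> /(congr1 (fun h => hf h x)); rewrite !ffunE unlift_none unlift_none.
by move/eqP; rewrite (negbTE (neq_lift _ _)).
Qed.

Lemma FIpoint_factor n l m (x : 'I_n) (g : G) (a : FIhom G l m)
    (h : FIhom G n.-1 m) b :
  FIcomp (FIup h) (FIpoint x g) = FIcomp (FIup a) b ->
  exists h', h = FIcomp a h'.
Proof.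
move=> e; apply: FI_factor => y.
have := congr1 (fun h => hf h (lift x y)) e; rewrite !ffunE !liftK !ffunE.
case: unliftP => [z _|_].
  by rewrite !ffunE => /lift_inj ->; exists z.
by move/esym/eqP; rewrite (negbTE (neq_lift _ _)).
Qed.

(** By [FI_split], a function on morphisms to [n+1] is its values on those missing [ord0], the image
    of [to_shift], and on those hitting it. The latter, indexed by the preimage of [ord0] and its
    label, form a function module one degree lower. *)
Lemma good_fun d (I : Type) (r : I -> nat) (W : I -> lmodType k) :
  (forall i, r i < d)%N -> good d (funFI G r W).
Proof.
elim: d I r W => [|d IH] I r W rd /=.
  by move=> n f; apply: fun_car_eq => i; have := rd i; rewrite ltn0.
split; first exact: to_shift_fun_inj.
pose I' := {i : I & ('I_(r i) * G)%type}.
pose r' (t : I') := (r (tag t)).-1.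
pose W' (t : I') := W (tag t).
pose phi n (f : shift (funFI G r W) n) : funFI G r' W' n :=
  fun t h => f (tag t) (FIcomp (FIup h) (FIpoint (tagged t).1 (tagged t).2)).
have phi_lin n : linear (@phi n) by move=> c f g; apply: fun_car_eq.
have phi_nat n m (a : FIhom G n m) f :
    phi m (Vmap (shift (funFI G r W)) a f) =
    Vmap (funFI G r' W') a (phi n f).
  apply: fun_car_eq => t h; rewrite /phi /=.
  case: (pselect (exists h', h = FIcomp a h')) => [[h' ->]|ne].
    by rewrite push_in FIup_comp -FIcompA push_in.
  by rewrite !push_out // => -[b /FIpoint_factor].
exists (funFI G r' W'), (FImor_of phi_lin phi_nat); split.
  move=> n f; split=> [f0|[f' <-]]; last first.
    apply: fun_car_eq => t h; rewrite /= /phi /= push_out //.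
    by move=> -[b /FIpoint_iota].
  exists (fun i h => f i (FIcomp (FIiota G n) h)).
  apply: fun_car_eq => i h /=.
  have [[b ->]|[x [g [b ->]]]] := FI_split h; first by rewrite push_in.
  rewrite push_out; last by move=> -[b' /FIpoint_iota].
  exact: esym (congr1 (fun f : fun_car G r' W' n =>
                         f (Tagged _ (x, g) : I') b) f0).
(* The point [x] makes [r i] positive, so the predecessor really drops. *)
apply: IH => -[i [x g]]; rewrite /r' /=.
by have := rd i; case: (r i) x => [[]|//].
Qed.

End FunctionModuleDerivative.

(** * Free covers *)

Section FreeCover.
Variables (G : group) (k : comPzRingType) (V : FImod G k) (d : nat).

Local Notation funV := (funFI G (fun i : 'I_d.+1 => i : nat) (fun i => V i)).
Local Notation carV := (fun_car G (fun i : 'I_d.+1 => i : nat) (fun i => V i)).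

(* The summand [M(V_i)_n = k[Hom([i],[n])] (x)_{kG_i} V_i] is the module of
   functions [Hom([i],[n]) -> V_i] that are equivariant under [G_i], because
   [G_i] acts freely and with finitely many orbits on [Hom([i],[n])]. *)
Definition equivariant n (f : funV n) :=
  forall (i : 'I_d.+1) (g : FIhom G i i) (h : FIhom G i n),
    Vmap V g ((f : carV n) i (FIcomp h g)) = (f : carV n) i h.

Lemma equivariant_sub : is_submodule equivariant.
Proof.
split=> [n i g h|n f f' ef ef' i g h|n c f ef i g h|n m a f ef i g h].
- exact: linear0.
- by rewrite [LHS]linearD ef ef'.
- by rewrite [LHS]linearZ /= ef.
- have [g' [gg' g'g]] := FIendo_inv g; rewrite /=.
  case: (pselect (exists h', h = FIcomp a h')) => [[h' ->]|ne].
    by rewrite -FIcompA !push_in ef.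
  rewrite !push_out ?linear0 // => -[h' e]; apply: ne.
  by exists (FIcomp h' g'); rewrite FIcompA -e -FIcompA gg' FIcomp1r.
Qed.

Definition cover : FImod G k := subFI equivariant_sub.
Local Notation ev f := (sval f : carV _).

Definition cover_gr (i : 'I_d.+1) : GrMod G k i :=
  @GrModule G k i (V i) (fun a => Vmap V a) (@Vmap_id G k V i)
    (@Vmap_comp G k V i i i).

(* The function corresponding to [id (x) w]: it is supported on the
   isomorphisms [h], where its value is [h^-1 w]. *)
Definition delta n (w : V n) : carV n :=
  fun i h => if pselect (exists p, FIcomp h p = FIid G n) is left e
             then Vmap V (sval (cid e)) w else 0.

Lemma delta_in n w (i : 'I_d.+1) (h : FIhom G i n) p :
  FIcomp h p = FIid G n -> delta w h = Vmap V p w.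
Proof.
move=> hp; rewrite /delta; case: pselect => [e|[]]; last by exists p.
by congr (Vmap V _ w); apply: (@FIcompI _ _ _ _ h); rewrite (svalP (cid e)).
Qed.

Lemma delta_out n w (i : 'I_d.+1) (h : FIhom G i n) :
  ~ (exists p, FIcomp h p = FIid G n) -> delta w h = 0.
Proof. by rewrite /delta; case: pselect. Qed.

Lemma delta_equivariant n (w : V n) : equivariant (delta w : funV n).
Proof.
move=> i g h; have [g' [gg' g'g]] := FIendo_inv g.
case: (pselect (exists p, FIcomp h p = FIid G n)) => [[p hp]|ne].
  rewrite (delta_in w hp) (@delta_in _ w _ _ (FIcomp g' p)).
    by rewrite -Vmap_comp FIcompA gg' FIcomp1l.
  by rewrite -FIcompA (FIcompA g) gg' FIcomp1l.
rewrite !delta_out ?linear0 // => -[p e]; apply: ne.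
by exists (FIcomp g p); rewrite FIcompA.
Qed.

Definition cover_in_fun (i : 'I_d.+1) (w : cover_gr i) : cover i :=
  exist _ (delta w : funV i) (delta_equivariant w).

Lemma cover_in_linear i : linear (@cover_in_fun i).
Proof.
move=> c v w; apply: sub_car_eq; apply: fun_car_eq => i' h.
rewrite [RHS]/= /cover_in_fun /= fun_lcE.
case: (pselect (exists p, FIcomp h p = FIid G i)) => [[p hp]|ne].
  by rewrite !(delta_in _ hp) linearP.
by rewrite !delta_out // scaler0 addr0.
Qed.

Definition cover_in i : {linear cover_gr i -> cover i} :=
  linear_of (@cover_in_linear i).

Lemma cover_in_equivariant (i : 'I_d.+1) (a : FIhom G i i) w :
  cover_in i (gm_act (cover_gr i) a w) = Vmap cover a (cover_in i w).
Proof.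
apply: sub_car_eq; apply: fun_car_eq => i' h; rewrite /=.
have [b [ab ba]] := FIendo_inv a.
have -> : h = FIcomp a (FIcomp b h) by rewrite FIcompA ab FIcomp1l.
move: (FIcomp b h) => {}h; rewrite push_in.
case: (pselect (exists p, FIcomp h p = FIid G i)) => [[p hp]|ne].
  rewrite (delta_in w hp) (@delta_in _ _ _ _ (FIcomp p b)).
    by rewrite -Vmap_comp -FIcompA ba FIcomp1r.
  by rewrite -FIcompA (FIcompA h) hp FIcomp1l.
rewrite !delta_out // => -[p e]; apply: ne; exists (FIcomp p a).
apply: (@FIcompI _ _ _ _ a).
by rewrite FIcomp1r !FIcompA [FIcomp (FIcomp a h) p]e FIcomp1l.
Qed.

(** * Orbits of morphisms and the universal property of the cover *)

Definition img l n (h : FIhom G l n) : {set 'I_n} := hf h @: setT.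

Lemma mem_img l n (h : FIhom G l n) x : hf h x \in img h.
Proof. by apply/imsetP; exists x. Qed.

(** For [l = l'], morphisms with equal images differ by an endomorphism, so images index the
    orbits. *)
Lemma img_factor l l' n (h : FIhom G l n) (h' : FIhom G l' n) :
  img h \subset img h' -> exists g, h = FIcomp h' g.
Proof.
move=> /subsetP s; apply: FI_factor => x.
by have /s/imsetP[y _ ->] := mem_img h x; exists y.
Qed.

Lemma img_comp l n m (a : FIhom G n m) (h : FIhom G l n) :
  img (FIcomp a h) = hf a @: img h.
Proof. by rewrite /img -imset_comp; apply: eq_imset => x; rewrite /= ffunE. Qed.

Lemma img_endo n (h : FIhom G n n) : img h = setT.
Proof.
apply/setP => x; rewrite inE; apply/imsetP.
exists (invF (@hfI _ _ _ h) x) => //.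
by rewrite f_invF.
Qed.

Section Universal.
Variables (X : FImod G k) (t : forall i, {linear cover_gr i -> X i}).
Hypothesis t_equiv : forall (i : 'I_d.+1) (a : FIhom G i i) w,
  t i (gm_act (cover_gr i) a w) = Vmap X a (t i w).

(* [Vmap X h (t i (f h))] depends only on the orbit of [h], i.e. on [img h]. *)
Definition term n (f : cover n) (i : 'I_d.+1) (S : {set 'I_n}) : X n :=
  if pselect (exists h : FIhom G i n, img h = S) is left e
  then Vmap X (sval (cid e)) (t i (ev f i (sval (cid e)))) else 0.

Lemma term_in n (f : cover n) (i : 'I_d.+1) (h : FIhom G i n) :
  term f i (img h) = Vmap X h (t i (ev f i h)).
Proof.
rewrite /term; case: pselect => [e|[]]; last by exists h.
move: (sval _) (svalP (cid e)) => h0 eh0.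
have [|g ->] := @img_factor _ _ _ h h0; first by rewrite eh0.
rewrite Vmap_comp -t_equiv /=; congr (Vmap X _ (t i _)).
by rewrite (svalP f).
Qed.

Lemma term_out n (f : cover n) (i : 'I_d.+1) S :
  ~ (exists h : FIhom G i n, img h = S) -> term f i S = 0.
Proof. by rewrite /term; case: pselect. Qed.

(** The map sending [h (x) w] to [Vmap X h (t i w)], summed over the finitely many orbits of each
    [i]. *)
Definition univ_fun n (f : cover n) : X n :=
  \sum_(i < d.+1) \sum_(S : {set 'I_n}) term f i S.

Lemma univ_linear n : linear (@univ_fun n).
Proof.
move=> c f g; rewrite /univ_fun scaler_sumr -big_split; apply: eq_bigr => i _.
rewrite scaler_sumr -big_split; apply: eq_bigr => S _ /=.
case: (pselect (exists h : FIhom G i n, img h = S)) => [[h <-]|ne].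
  by rewrite !term_in -!linearP.
by rewrite !term_out // scaler0 addr0.
Qed.

Lemma univ_nat n m (a : FIhom G n m) f :
  univ_fun (Vmap cover a f) = Vmap X a (univ_fun f).
Proof.
rewrite /univ_fun linear_sum; apply: eq_bigr => i _; rewrite linear_sum.
pose A := [set hf a @: (S : {set 'I_n}) | S : {set 'I_n}].
(* Subsets outside the image of [a] contribute 0, because [push] extends by zero. *)
rewrite (bigID (mem A)) /= [X in _ + X]big1 ?addr0 => [|S /imsetP nS].
  rewrite big_imset /=; last first.
    by move=> S S' _ _; apply: imset_inj; exact: hfI.
  apply: eq_big => [S|S _]; first by rewrite inE.
  case: (pselect (exists h : FIhom G i n, img h = S)) => [[h <-]|ne].
    by rewrite -img_comp !term_in /= push_in Vmap_comp.
  rewrite !term_out ?linear0 // => -[h eh]; apply: ne.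
  have [x|b e] := @FI_factor _ _ _ _ a h.
    by have := mem_img h x; rewrite eh => /imsetP[y _ ->]; exists y.
  exists b; apply: (@imset_inj _ _ (hf a)); first exact: hfI.
  by rewrite -img_comp -e.
case: (pselect (exists h : FIhom G i m, img h = S)) => [[h eh]|ne]; last first.
  by rewrite term_out.
rewrite -eh term_in /= push_out ?linear0 // => -[b e]; apply: nS.
by exists (img b) => //; rewrite -img_comp -e.
Qed.

(** Only isomorphisms support [delta], so the one surviving term has index [i] and full image. *)
Lemma univ_cover_in i w : univ_fun (cover_in i w) = t i w.
Proof.
rewrite /univ_fun (bigD1 i) //= [X in _ + X]big1 ?addr0 => [|i' ne]; last first.
  apply: big1 => S _.
  case: (pselect (exists h : FIhom G i' i, img h = S)) => [[h <-]|]; last first.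
    exact: term_out.
  rewrite term_in /= delta_out ?linear0 // => -[p _].
  case/eqP: ne; apply: val_inj; apply/eqP; rewrite eqn_leq /=.
  by rewrite (FIhom_leq h) (FIhom_leq p).
rewrite (bigD1 setT) //= [X in _ + X]big1 ?addr0 => [|S ne]; last first.
  by apply: term_out => -[h eh]; case/eqP: ne; rewrite -eh img_endo.
rewrite -(img_endo (FIid G i)) term_in Vmap_id /=.
by rewrite (@delta_in _ _ _ _ (FIid G i)) ?Vmap_id // FIcomp1l.
Qed.

End Universal.

Lemma ev_linear n (i : 'I_d.+1) (h : FIhom G i n) :
  linear (fun f : cover n => ev f i h).
Proof. by []. Qed.

(** Writes [f] through translates of generators, which gives uniqueness in the universal
    property. *)
Lemma cover_decomp n (f : cover n) : f = univ_fun cover_in f.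
Proof.
apply: sub_car_eq; apply: fun_car_eq => i h.
have -> : ev (univ_fun cover_in f) i h =
    linear_of (ev_linear h) (univ_fun cover_in f) by [].
have termE (i' : 'I_d.+1) S :
    linear_of (ev_linear h) (term cover_in f i' S) =
    if (i' == i) && (S == img h) then ev f i h else 0.
  case: (pselect (exists h' : FIhom G i' n, img h' = S))
      => [[h' <-]|ne]; last first.
    rewrite term_out // linear0; case: eqP => //= ei; case: eqP => // eS.
    by case: ne; rewrite ei eS; exists h.
  rewrite (term_in cover_in_equivariant) /=.
  case: (pselect (exists b, h = FIcomp h' b)) => [[b eb]|ne]; last first.
    rewrite push_out //; case: eqP => //= _; case: eqP => // e; case: ne.
    by apply: img_factor; rewrite e.
  case: (pselect (exists p, FIcomp b p = FIid G i')) => [[p bp]|ne].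
    have ei : i' = i.
      apply: val_inj; apply/eqP; rewrite eqn_leq /=.
      by rewrite (FIhom_leq b) (FIhom_leq p).
    subst i'; rewrite eqxx eb push_in (delta_in _ bp) img_comp img_endo eqxx /=.
    rewrite -(svalP f i b h') -Vmap_comp.
    suff -> : FIcomp p b = FIid G i by rewrite Vmap_id.
    by apply: (@FIcompI _ _ _ _ b); rewrite FIcompA bp FIcomp1l FIcomp1r.
  rewrite eb push_in delta_out //; case: eqP => //= ei; case: ne; subst i'.
  by have [p []] := FIendo_inv b; exists p.
rewrite linear_sum; under eq_bigr => i' _.
  by rewrite linear_sum; under eq_bigr do rewrite termE; over.
rewrite (bigD1 i) //= [X in _ + X]big1 => [|i' /negbTE ->]; last exact: big1.
rewrite addr0 (bigD1 (img h)) //= !eqxx /= big1 ?addr0 // => S /negbTE -> //.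
Qed.

Lemma cover_free : free_fin_gen cover.
Proof.
exists d, 'I_d.+1, (fun i => i : nat), cover_gr, cover_in; split.
- by move=> i; rewrite -ltnS.
- exact: cover_in_equivariant.
move=> X t t_equiv.
exists (FImor_of (univ_linear t_equiv) (univ_nat t_equiv)); split.
  by move=> i w; exact: univ_cover_in.
move=> u' u'E n f; rewrite /= {1}(cover_decomp f) /univ_fun linear_sum.
apply: eq_bigr => i _; rewrite linear_sum; apply: eq_bigr => S _.
case: (pselect (exists h : FIhom G i n, img h = S)) => [[h <-]|ne].
  by rewrite (term_in cover_in_equivariant) (term_in t_equiv) mor_nat u'E.
by rewrite !term_out // linear0.
Qed.

Lemma cover_sub_FP K (e : FImor K cover) : inj e -> gen_fin_deg K -> FP K.
Proof.
apply: (good_embed (d := d.+1) (e := sub_incl equivariant_sub)).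
  exact: sub_incl_inj.
by apply: good_fun => i.
Qed.

(** The identities of the [V i] extend to a map whose image contains all degrees up to [d]. *)
Lemma cover_surj :
  (forall S, is_submodule S -> (forall n, (n <= d)%N -> forall x, S n x) ->
     forall n (x : V n), S n x) ->
  exists p : FImor cover V, surj p.
Proof.
move=> gV.
pose t (i : 'I_d.+1) : {linear cover_gr i -> V i} :=
  linear_of (f := fun x : V i => x) (fun c x y => erefl).
have t_equiv (i : 'I_d.+1) (a : FIhom G i i) w :
  t i (gm_act (cover_gr i) a w) = Vmap V a (t i w) by [].
pose p := FImor_of (univ_linear t_equiv) (univ_nat t_equiv).
have all : forall n x, image p (@full G k cover) (n := n) x.
  apply: gV; first exact/is_submodule_image/is_submodule_full.
  move=> n le x; pose i : 'I_d.+1 := Ordinal (le : (n < d.+1)%N).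
  exists (cover_in i (x : V i)) => //.
  exact: (univ_cover_in t_equiv (i := i) x).
by exists p => n y; have [x _ <-] := all n y; exists x.
Qed.

End FreeCover.

(** * Coherent modules form an abelian category *)

Section Coherent.
Variables (G : group) (k : comPzRingType).
Local Notation FImod := (FImod G k).
Implicit Types K U V W X Y : FImod.

(** The preimage of [K] in a free cover of [Y] is an extension of [K] by the kernel of the cover,
    hence generated in finite degree and FP by [cover_sub_FP]; [K] is a quotient of it. *)
Lemma FP_sub K Y (e : FImor K Y) : inj e -> gen_fin_deg K -> FP Y -> FP K.
Proof.
move=> e_inj gK [[d gY] FPY].
have [p ps] := cover_surj gY; set C := cover Y d in p ps.
have gC : gen_fin_deg C := free_gen (cover_free Y d).
have Esub := is_submodule_image e (is_submodule_full K).
have [K' [e' [e'_inj e'E]]] := exists_sub (is_submodule_preim p Esub).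
have [|h hE] := lift_mono (e := e) (h := mcomp p e') e_inj.
  move=> n x; have [|y _ ey] := proj2 (e'E n (e' n x)); first by exists x.
  by exists y.
have hs : surj h.
  move=> n y; have [x px] := ps n (e n y).
  have [|z ez] := proj1 (e'E n x); first by exists y.
  by exists z; apply: e_inj; rewrite hE /= ez.
have gk : fg (ker h).
  apply: (fg_image_inj e'_inj); apply: fg_eq (FPY _ _ ps gC) => n x.
  rewrite /ker; split=> [px|[z hz <-]]; last first.
    by have := hE n z; rewrite hz linear0 => /esym.
  have [|z ez] := proj1 (e'E n x); first by exists 0; rewrite // px linear0.
  by exists z => //; apply: e_inj; rewrite hE /= ez px linear0.
apply: (FP_quotient hs gk); apply: (cover_sub_FP e'_inj).
exact: gen_ext hs.
Qed.

Lemma dw_coherentE V : dw_coherent V <-> FP V.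
Proof.
split=> [[K [F [i [p [freeF gK i_inj ps pE]]]]]|[gV FPV]].
  apply: (FP_quotient (f := p)) => //; last exact: free_FP.
  exact/(fg_embedded i_inj pE).
have [d gd] := gV; have [p ps] := cover_surj gd.
have [K [i [i_inj iE]]] := exists_sub (is_submodule_ker p).
exists K, (cover V d), i, p; split=> //; first exact: cover_free.
by apply/(fg_embedded i_inj iE)/FPV => //; exact/free_gen/cover_free.
Qed.

(** The image of [f] is FP as a submodule of [Y], so the kernel is generated in finite degree;
    [FP_sub] in [X] then applies. *)
Lemma FP_ker K X Y (f : FImor X Y) (e : FImor K X) :
  inj e -> (forall n x, ker f x <-> exists y, e n y = x) ->
  FP X -> FP Y -> FP K.
Proof.
move=> e_inj eE FPX FPY; apply: (FP_sub e_inj) => //.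
apply/(fg_embedded e_inj eE).
have [I [i [i_inj iE]]] :=
  exists_sub (is_submodule_image f (is_submodule_full X)).
have [|g gE] := lift_mono (e := i) (h := f) i_inj.
  by move=> n x; apply/iE; exists x.
have gs : surj g.
  move=> n y; have [|x _ fx] := proj2 (iE n (i n y)); first by exists y.
  by exists x; apply: i_inj; rewrite gE.
have [gX _] := FPX.
have [_ FPI] : FP I by apply: (FP_sub i_inj) => //; exact: gen_surj gs gX.
apply: fg_eq (FPI _ _ gs gX) => n x; rewrite /ker -gE.
split=> [->|e0]; first exact: linear0.
by apply: i_inj; rewrite e0 linear0.
Qed.

Lemma FP_coker X Y C (f : FImor X Y) (q : FImor Y C) :
  surj q -> (forall n y, q n y = 0 <-> image f (@full G k X) y) ->
  FP X -> FP Y -> FP C.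
Proof.
move=> qs qE [/fg_full gX _]; apply: (FP_quotient qs).
by apply: fg_eq (fg_image f gX) => n y; split=> /qE.
Qed.

Lemma FP_zero_object : has_zero_object (@FP G k).
Proof.
pose Z := @funFI G k void (fun=> 0%N) (fun v => match v with end).
have Z0 n (x y : Z n) : x = y by apply: fun_car_eq; case.
exists Z; split; first by apply: (FP_bounded (N := 0)) => n x _; exact: Z0.
move=> X _; split; split; do ?[by exists (mzero _ _)].
  by move=> u v n x; rewrite (Z0 n x 0) !linear0.
by move=> u v n x; exact: Z0.
Qed.

Lemma FP_biproducts : has_biproducts (@FP G k).
Proof.
move=> X Y FPX FPY; exists (prodFI X Y); split.
  apply: (FP_extension (e := pinr X Y) (f := pfst X Y)) FPY FPX.
  - by move=> n x y [].
  - by move=> n [x y] /=; split=> [->|[z [<-]]] //; exists y.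
  - by move=> n x; exists (x, 0).
exists (pinl X Y), (pinr X Y), (pfst X Y), (psnd X Y).
by split=> // n [x y]; congr pair; rewrite /= ?addr0 ?add0r.
Qed.

Lemma FP_kernels : has_kernels (@FP G k).
Proof.
move=> X Y f FPX FPY.
have [K [e [e_inj eE]]] := exists_sub (is_submodule_ker f).
exists K, e; split; first exact: (FP_ker e_inj eE).
split=> [n x|T _ h fh]; first by apply/eE; exists x.
have [|u uE] := lift_mono (e := e) (h := h) e_inj.
  by move=> n x; apply/eE/fh.
by exists u; split=> // u' u'E n x; apply: e_inj; rewrite uE u'E.
Qed.

Lemma FP_cokernels : has_cokernels (@FP G k).
Proof.
move=> X Y f FPX FPY.
have [C [q [qs qE]]] :=
  exists_quo (is_submodule_image f (is_submodule_full X)).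
exists C, q; split; first exact: (FP_coker qs qE).
split=> [n x|T _ h hf]; first by apply/qE; exists x.
have [|u uE] := lift_epi (q := q) (h := h) qs.
  by move=> n _ /qE[x _ <-]; exact: hf.
exists u; split=> // u' u'E n y; have [x <-] := qs n y.
by rewrite uE u'E.
Qed.

Lemma FP_monos : monos_are_kernels (@FP G k).
Proof.
move=> X Y f FPX FPY f_mono.
have f_inj : inj f.
  have [K [e [e_inj eE]]] := exists_sub (is_submodule_ker f).
  apply: inj_ker0 => n x /eE[y <-].
  (* Monos are tested only against FP objects, and the pointwise kernel is one of them. *)
  apply: (f_mono K (FP_ker e_inj eE FPX FPY) e (mzero K X)) => m z /=.
  by rewrite linear0; apply/eE; exists z.
have [C [q [qs qE]]] :=
  exists_quo (is_submodule_image f (is_submodule_full X)).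
exists C, q; split; first exact: (FP_coker qs qE).
split=> [n x|T _ h qh]; first by apply/qE; exists x.
have [|u uE] := lift_mono (e := f) (h := h) f_inj.
  by move=> n x; have /qE[y _ <-] := qh n x; exists y.
by exists u; split=> // u' u'E n x; apply: f_inj; rewrite uE u'E.
Qed.

Lemma FP_epis : epis_are_cokernels (@FP G k).
Proof.
move=> X Y f FPX FPY f_epi.
have fs : surj f.
  have [C [q [qs qE]]] :=
    exists_quo (is_submodule_image f (is_submodule_full X)).
  move=> n y; suff /qE[x _ <-] : q n y = 0 by exists x.
  (* Dually, the pointwise cokernel is an admissible test object. *)
  apply: (f_epi C (FP_coker qs qE FPX FPY) q (mzero Y C)) => m x /=.
  by apply/qE; exists x.
have [K [e [e_inj eE]]] := exists_sub (is_submodule_ker f).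
exists K, e; split; first exact: (FP_ker e_inj eE).
split=> [n x|T _ h he]; first by apply/eE; exists x.
have [|u uE] := lift_epi (q := f) (h := h) fs.
  by move=> n x /eE[y <-]; exact: he.
exists u; split=> // u' u'E n y; have [x <-] := fs n y.
by rewrite uE u'E.
Qed.

End Coherent.

Theorem theoremB (G : group) (k : comPzRingType) :
  abelian_full_subcat (@dw_coherent G k).
Proof.
have -> : @dw_coherent G k = @FP G k.
  by apply: funext => V; apply/propext/dw_coherentE.
do 5?split; [exact: FP_zero_object | exact: FP_biproducts | exact: FP_kernels |
  exact: FP_cokernels | exact: FP_monos | exact: FP_epis].
Qed.
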